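(* The $\mathcal{W}$-property is inherited by factors and subsystems: every factor and every subsystem of a $\mathcal{W}$-system is a $\mathcal{W}$-system. Products and inverse limits of $\mathcal{W}$-systems are $\mathcal{W}$-systems.
   Context: A dynamical system is a pair $(X,s)$ with $X$ a compact Hausdorff space and $s:X\to X$ a homeomorphism. A subsystem is $(Y,s|_Y)$ with $Y\subseteq X$ non-empty, closed and $s(Y)=Y$. A homomorphism $\pi:(X,s)\to(Y,t)$ is a continuous surjection $\pi:X\to Y$ with $\pi\circ s=t\circ\pi$; if one exists, $(Y,t)$ is a factor of $(X,s)$. The product of a family $(X_i,s_i)_{i\in I}$ is $\prod_iX_i$ with the coordinatewise homeomorphism; inverse limits are taken over directed sets along homomorphisms, as subsystems of the product. The enveloping semigroup $E(X,s)$ is the closure of $\{s^n:n\in\mathbb{Z}\}$ in the product space $X^X$; $(E(X,s),\lambda_s)$ is the dynamical system with $\lambda_s(a)=s\circ a$. $\mathbb{T}$ is the unit circle in $\mathbb{C}$; $\mathcal{C}(X)$ is the algebra of continuous complex functions on $X$ (supremum norm); $\mathcal{C}(X,\mathbb{T})$ the multiplicative group of continuous functions $X\to\mathbb{T}$; $s^*f=f\circ s$. Let $G_0(X,s)$ be the constant functions $X\to\mathbb{T}$, $G_{m+1}(X,s)=\{g\in\mathcal{C}(X,\mathbb{T}): s^*g=fg\text{ for some }f\in G_m(X,s)\}$, $G(X,s)=\bigcup_{m\ge0}G_m(X,s)$. $(X,s)$ has (topological) quasi-discrete spectrum if the linear span of $G(X,s)$ is dense in $\mathcal{C}(X)$.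 $(X,s)$ is a $\mathcal{W}$-system (has the $\mathcal{W}$-property) if $(E(X,s),\lambda_s)$ has quasi-discrete spectrum. *)

(* Defs.v *)
From HB Require Import structures.
From mathcomp Require Import all_boot all_order all_algebra.
From mathcomp Require Import all_classical all_reals all_analysis.
From mathcomp Require Import complex.

Set Implicit Arguments.
Unset Strict Implicit.
Unset Printing Implicit Defensive.

Import Order.TTheory GRing.Theory Num.Theory.
Import numFieldNormedType.Exports.

Local Open Scope classical_set_scope.
Local Open Scope ring_scope.

(* Typing the complex numbers as a numClosedFieldType is what lets inference
   find their usual (norm) topology and uniformity. *)
Definition Cx (R : realType) : numClosedFieldType := R[i].

(* The inverse is part of the data, so that negative iterates are available;
   it is determined by the map. *)
Record dynSys := DynSys {
  ds_space :> topologicalType;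
  ds_map : ds_space -> ds_space;
  ds_inv : ds_space -> ds_space;
  ds_compact : compact [set: ds_space];
  ds_hausdorff : hausdorff_space ds_space;
  ds_mapK : cancel ds_map ds_inv;
  ds_invK : cancel ds_inv ds_map;
  ds_map_continuous : continuous ds_map;
  ds_inv_continuous : continuous ds_inv }.

Definition ds_iter (X : dynSys) (n : int) : X -> X :=
  match n with
  | Posz k => iter k (@ds_map X)
  | Negz k => iter k.+1 (@ds_inv X)
  end.

Definition is_hom (X Y : dynSys) (p : X -> Y) : Prop :=
  [/\ continuous p, (forall y, exists x, p x = y)
    & forall x, p (ds_map x) = ds_map (p x)].

Definition is_factor_of (Y X : dynSys) : Prop := exists p : X -> Y, is_hom p.

Definition is_subsystem (X : dynSys) (A : set X) : Prop :=
  [/\ A !=set0, closed A & @ds_map X @` A = A].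

Section Restriction.
Context (X : dynSys) (A : set X).
Hypotheses (clA : closed A) (sA : @ds_map X @` A = A).

Lemma ds_mapA x : A x -> A (ds_map x).
Proof. by move=> Ax; rewrite -sA; exists x. Qed.

Lemma ds_invA x : A x -> A (ds_inv x).
Proof. by rewrite -{1}sA => -[y Ay <-]; rewrite ds_mapK. Qed.

Definition sub_map (x : A) : A :=
  exist (fun y => y \in A) _ (mem_set (ds_mapA (set_valP x))).
Definition sub_inv (x : A) : A :=
  exist (fun y => y \in A) _ (mem_set (ds_invA (set_valP x))).

Lemma sub_val_inj (x y : A) : set_val x = set_val y -> x = y.
Proof. exact: val_inj. Qed.

Lemma sub_compact : compact [set: A].
Proof.
have cA : compact A.
  exact: (subclosed_compact clA (@ds_compact X) (@subsetT _ _)).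
move=> F FF _.
have FA : (set_val @ F) A.
  by apply: (@filterS _ F _ setT _ _ filterT) => x _; exact: set_valP.
have [p [Ap clp]] := cA (set_val @ F) (fmap_proper_filter _ FF) FA.
exists (exist (fun y => y \in A) p (mem_set Ap)); split => // B N FB.
move=> [_ [[W oW <-] Wp WN]].
have FB' : (set_val @ F) (set_val @` B).
  by apply: (@filterS _ F _ B _ _ FB) => x Bx; exists x.
have [_ [[x Bx <-] Wx]] := clp _ W FB' (open_nbhs_nbhs (conj oW Wp)).
by exists x; split => //; exact: WN.
Qed.

Lemma sub_hausdorff : hausdorff_space A.
Proof.
move=> x y xy; apply: sub_val_inj; apply: (@ds_hausdorff X) => B C nB nC.
have [z [Bz Cz]] := xy _ _ (@initial_continuous A X set_val x B nB)
                           (@initial_continuous A X set_val y C nC).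
by exists (set_val z).
Qed.

Lemma sub_map_continuous : continuous sub_map.
Proof.
apply: continuous_comp_initial => x.
apply: (@continuous_comp A X X set_val (@ds_map X)).
  exact: initial_continuous.
exact: ds_map_continuous.
Qed.

Lemma sub_inv_continuous : continuous sub_inv.
Proof.
apply: continuous_comp_initial => x.
apply: (@continuous_comp A X X set_val (@ds_inv X)).
  exact: initial_continuous.
exact: ds_inv_continuous.
Qed.

Lemma sub_mapK : cancel sub_map sub_inv.
Proof. by move=> x; apply: sub_val_inj; exact: ds_mapK. Qed.

Lemma sub_invK : cancel sub_inv sub_map.
Proof. by move=> x; apply: sub_val_inj; exact: ds_invK. Qed.

Definition restr_sys : dynSys :=
  @DynSys A sub_map sub_inv sub_compact sub_hausdorff sub_mapK sub_invK
    sub_map_continuous sub_inv_continuous.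

End Restriction.

Definition subsystem (X : dynSys) (A : set X) (hA : is_subsystem A) : dynSys :=
  let: And3 _ clA sA := hA in restr_sys clA sA.

Section Product.
Context (I : Type) (X : I -> dynSys).

Definition prod_space : topologicalType :=
  prod_topology (fun i => X i : topologicalType).

Definition prod_map (f : prod_space) : prod_space := fun i => ds_map (f i).
Definition prod_inv (f : prod_space) : prod_space := fun i => ds_inv (f i).

Lemma prod_compact : compact [set: prod_space].
Proof.
have := @tychonoff {classic I} (fun i => X i : topologicalType)
  (fun=> setT) (fun i => @ds_compact (X i)).
by congr compact; apply/seteqP; split.
Qed.

Lemma prod_hausdorff : hausdorff_space prod_space.
Proof.
exact: (@hausdorff_product {classic I} (fun i => X i : topologicalType)
  (fun i => @ds_hausdorff (X i))).
Qed.

Lemma prod_mapK : cancel prod_map prod_inv.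
Proof. by move=> f; apply: functional_extensionality_dep => i; exact: ds_mapK. Qed.

Lemma prod_invK : cancel prod_inv prod_map.
Proof. by move=> f; apply: functional_extensionality_dep => i; exact: ds_invK. Qed.

Lemma coord_continuous i : continuous (fun f : prod_space => f i).
Proof.
exact: (@proj_continuous {classic I} (fun i => X i : topologicalType) i).
Qed.

Lemma coordwise_continuous (h : forall i, X i -> X i) :
  (forall i, continuous (h i)) ->
  continuous (fun f : prod_space => (fun i => h i (f i)) : prod_space).
Proof.
move=> ch f.
have FF : Filter ((fun g : prod_space => (fun i => h i (g i)) : prod_space) @ f).
  exact: (fmap_filter _ (nbhs_filter f)).
apply/cvg_sup => i U [_ [[W oW <-] Wf WU]].
have nfW : nbhs f (fun g : prod_space => W (h i (g i))).
  apply: (continuous_comp (@coord_continuous i f) (ch i (f i))).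
  exact: open_nbhs_nbhs.
by apply: (filterS _ nfW) => g Wg; exact: WU.
Qed.

Definition prod_sys : dynSys :=
  @DynSys prod_space prod_map prod_inv prod_compact prod_hausdorff
    prod_mapK prod_invK
    (coordwise_continuous (fun i => @ds_map_continuous (X i)))
    (coordwise_continuous (fun i => @ds_inv_continuous (X i))).

End Product.

Record is_directed (I : Type) (le : I -> I -> Prop) : Prop := IsDirected {
  dir_inhabited : inhabited I;
  dir_refl : forall i, le i i;
  dir_trans : forall i j k, le i j -> le j k -> le i k;
  dir_ub : forall i j, exists k, le i k /\ le j k }.

Record is_inverse_system (I : Type) (le : I -> I -> Prop) (X : I -> dynSys)
    (p : forall i j, le i j -> X j -> X i) : Prop := IsInverseSystem {
  inv_directed : is_directed le;
  inv_hom : forall i j (h : le i j), is_hom (p i j h);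
  inv_id : forall i (h : le i i) x, p i i h x = x;
  inv_comp : forall i j k (hij : le i j) (hjk : le j k) (hik : le i k) x,
    p i j hij (p j k hjk x) = p i k hik x }.

Section InverseLimit.
Context (I : Type) (le : I -> I -> Prop) (X : I -> dynSys)
  (p : forall i j, le i j -> X j -> X i).
Hypothesis hp : is_inverse_system p.

Definition inv_lim_set : set (prod_sys X) :=
  [set x | forall i j (h : le i j), p h (x j) = x i].

Lemma inv_lim_closed : closed inv_lim_set.
Proof.
move=> x clx i j h; apply: (@ds_hausdorff (X i)) => A B nA nB.
have [cp _ _] := inv_hom hp h.
have nA' : nbhs x (fun y : prod_sys X => A (p h (y j))).
  exact: (continuous_comp (@coord_continuous I X j x) (cp (x j))).
have nB' : nbhs x (fun y : prod_sys X => B (y i)).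
  exact: (@coord_continuous I X i x).
have [y [ly [Ay By]]] := clx _ (filterI nA' nB').
by exists (y i); split => //; rewrite -(ly i j h).
Qed.

Lemma inv_lim_invariant : @ds_map (prod_sys X) @` inv_lim_set = inv_lim_set.
Proof.
apply/seteqP; split => [_ [x lx <-] i j h|x lx].
  have [_ _ ps] := inv_hom hp h.
  by rewrite -[LHS]/(p h (ds_map (x j))) ps lx.
exists (@ds_inv (prod_sys X) x); last exact: ds_invK.
move=> i j h; have [_ _ ps] := inv_hom hp h.
rewrite -[LHS]/(p h (ds_inv (x j))) -[RHS]/(ds_inv (x i)) -(lx i j h).
by rewrite -{2}[x j](@ds_invK (X j)) ps ds_mapK.
Qed.

Definition inv_lim : dynSys := restr_sys inv_lim_closed inv_lim_invariant.

End InverseLimit.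

Section Enveloping.
Context (X : dynSys).

Definition env_set : set (prod_sys (fun _ : X => X)) :=
  @closure (prod_sys (fun _ : X => X)) (range (@ds_iter X)).

Lemma ds_map_iter (n : int) : @ds_map X \o @ds_iter X n = @ds_iter X (n + 1).
Proof.
apply/funext => x; case: n => [k|[|k]].
- by rewrite -PoszD addn1.
- by rewrite /= ds_invK.
- have -> : Negz k.+1 + 1 = Negz k by rewrite !NegzE -[k.+2]addn1 PoszD opprD addrNK.
  by rewrite /= ds_invK.
Qed.

Lemma ds_inv_iter (n : int) : @ds_inv X \o @ds_iter X n = @ds_iter X (n - 1).
Proof.
rewrite -[n in LHS](subrK 1) -ds_map_iter.
by apply/funext => x /=; rewrite ds_mapK.
Qed.

Lemma env_closed : closed env_set.
Proof. exact: closed_closure. Qed.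

Lemma env_invariant : @ds_map (prod_sys (fun _ : X => X)) @` env_set = env_set.
Proof.
apply/seteqP; split => [_ [a Ea <-] B nB|a Ea].
  have [b [[n _ <-] Bb]] := Ea _ (@ds_map_continuous (prod_sys _) a B nB).
  by exists (@ds_map X \o @ds_iter X n); split => //; rewrite ds_map_iter; exists (n + 1).
exists (@ds_inv (prod_sys _) a); last exact: ds_invK.
move=> B nB.
have [b [[n _ <-] Bb]] := Ea _ (@ds_inv_continuous (prod_sys _) a B nB).
by exists (@ds_inv X \o @ds_iter X n); split => //; rewrite ds_inv_iter; exists (n - 1).
Qed.

(* The coordinatewise homeomorphism of the power X^X is a |-> s \o a, so its
   restriction to the closure of the powers of s is lambda_s. *)
Definition env_sys : dynSys := restr_sys env_closed env_invariant.

End Enveloping.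

Section QuasiDiscrete.
Context (R : realType) (X : dynSys).

Definition circle_fun : set (X -> Cx R) :=
  [set g | continuous g /\ forall x, `|g x| = 1].

Fixpoint quasi_eigen (m : nat) : set (X -> Cx R) :=
  match m with
  | 0 => [set g | exists2 c : Cx R, `|c| = 1 & g = cst c]
  | m'.+1 => [set g | circle_fun g /\
      exists2 f, quasi_eigen m' f & forall x, g (ds_map x) = f x * g x]
  end.

Definition quasi_eigen_all : set (X -> Cx R) :=
  \bigcup_(m in setT) quasi_eigen m.

Definition lin_span (S : set (X -> Cx R)) : set (X -> Cx R) :=
  [set f | exists n (c : 'I_n -> Cx R) (g : 'I_n -> X -> Cx R),
    (forall i, S (g i)) /\ forall x, f x = \sum_(i < n) c i * g i x].

(* On continuous functions, the topology of {uniform X -> Cx R} is that of the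
   supremum norm. *)
Definition quasi_discrete_spectrum : Prop :=
  [set f : {uniform X -> Cx R} | continuous (f : X -> Cx R)] `<=`
  closure (lin_span quasi_eigen_all : set {uniform X -> Cx R}).

End QuasiDiscrete.

Definition W_system (R : realType) (X : dynSys) : Prop :=
  quasi_discrete_spectrum R (env_sys X).

(* Main.v *)
Require Import Defs.
From mathcomp Require Import all_boot all_order all_algebra.
From mathcomp Require Import all_classical all_reals all_analysis.
From HB Require Import structures.
From mathcomp Require Import complex separable cyclotomic cyclic.
From mathcomp Require Import ring lra zify.

(* Let E be an enveloping semigroup with quasi-discrete spectrum. Its
   quasi-eigenfunctions behave like the sequences n |-> e(p(n)), p a real
   polynomial: right translation by an element of E acts on them
   unipotently. Hence the only idempotent of E is the identity, and E is a
   group by the Ellis-Numakura lemma.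

   Factors and subsystems of X have enveloping semigroups F that are factors
   of E = E(X), by the quotient of a closed normal subgroup N. So one has to
   approximate an N-invariant continuous function f on E by N-invariant
   quasi-eigenfunctions. Approximate f by a combination of quasi-eigenfunctions
   of degree at most m, modulo torsion (that is, up to rational polynomials),
   and suppose m >= 2. Either N acts trivially in degree m - 1, so that N
   multiplies the functions of degree m by constants, and averaging over N
   removes those that are not invariant; or every function g of degree exactly
   m is an eigenfunction with eigenvalue different from 1 of some element of N
   acting trivially in lower degrees, and averaging lowers the degree of the
   approximation. In the second case the element of N is a commutator [a, b]
   with a in N, or a limit of powers of such an a. That E contains enough
   elements b is a form of Weyl's equidistribution theorem: an element of
   degree j that is not of lower degree modulo torsion is multiplied by
   arbitrary constants of the circle under the stabilizer of degree j - 1.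

   Products need no group structure: the quasi-eigenfunctions coming from the
   coordinates separate points, so the Stone-Weierstrass theorem applies; and
   inverse limits are subsystems of products. *)

Set Implicit Arguments.
Unset Strict Implicit.
Unset Printing Implicit Defensive.

Import Order.TTheory GRing.Theory Num.Theory.
Import numFieldNormedType.Exports.

Local Open Scope classical_set_scope.
Local Open Scope ring_scope.

(** * The circle *)

Lemma geometric_growth (F : numFieldType) n : 1 + n%:R / 2 <= (3 / 2 : F) ^+ n.
Proof.
elim: n => [|n IH]; first by rewrite mul0r addr0.
rewrite exprSr; apply: le_trans (_ : (1 + n%:R / 2) * (3 / 2) <= _); last first.
  by rewrite ler_wpM2r // divr_ge0.
have -> : (1 + n%:R / 2) * (3 / 2) = 1 + n.+1%:R / 2 + n%:R / 4 :> F.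
  by rewrite -natr1; field.
by rewrite lerDl divr_ge0.
Qed.

Section Circle.
Context (R : realType).
Local Notation C := (Cx R).

Definition cis (t : R) : C := (cos t +i* sin t)%C.

Lemma cisD x y : cis (x + y) = cis x * cis y.
Proof. by rewrite /cis cosD sinD; congr Complex; exact: addrC. Qed.

Lemma cis0 : cis 0 = 1.
Proof. by rewrite /cis cos0 sin0. Qed.

Lemma cisMn x n : cis (x *+ n) = cis x ^+ n.
Proof. by elim: n => [|n IH]; rewrite ?mulr0n ?cis0 // mulrS cisD IH exprS. Qed.

Lemma norm_cis x : `|cis x| = 1.
Proof. by rewrite normc_def /= cos2Dsin2 sqrtr1. Qed.

Lemma cis_neg x : cis (- x) = (cis x)^-1.
Proof.
apply: (@mulfI _ (cis x)); first by rewrite -normr_eq0 norm_cis oner_eq0.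
by rewrite -cisD subrr cis0 divff // -normr_eq0 norm_cis oner_eq0.
Qed.

Lemma cis_2pi : cis (pi *+ 2) = 1.
Proof. by rewrite /cis cos2pi sin2pi. Qed.

Lemma cis_surj (z : C) : `|z| = 1 -> exists2 t, 0 <= t < pi *+ 2 & cis t = z.
Proof.
case: z => a b; rewrite normc_def /= => -[/(congr1 (fun x => x ^+ 2))].
rewrite sqr_sqrtr ?addr_ge0 ?sqr_ge0 // expr1n => ab1.
have a1 : -1 <= a <= 1.
  rewrite -ler_norml -(ler_pXn2r (_ : (0 < 2)%N)) ?nnegrE //.
  by rewrite expr1n real_normK ?num_real // -ab1 lerDl sqr_ge0.
have sa : sin (acos a) = `|b|.
  by rewrite sin_acos // -ab1 addrAC subrr add0r sqrtr_sqr.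
have [b0|b0] := leP 0 b.
  exists (acos a); last by rewrite /cis sa acosK ?in_itv //= ger0_norm.
  rewrite acos_ge0 //= (le_lt_trans (acos_lepi a1)) // mulr2n ltrDl pi_gt0 //.
have [e|e] := eqVneq (acos a) 0.
  by move: sa b0; rewrite e sin0 => /esym/eqP; rewrite normr_eq0 => /eqP ->; rewrite ltxx.
exists (pi *+ 2 - acos a).
  have := acos_ge0 a1; have := acos_lepi a1; have := @pi_gt0 R; rewrite mulr2n.
  move: e; rewrite neq_lt; lra.
by rewrite cisD cis_2pi mul1r /cis cosN sinN sa acosK ?in_itv //= ltr0_norm // opprK.
Qed.

Lemma norm_leReIm (z : C) : `|z| <= (`|complex.Re z| + `|complex.Im z|)%:C%C.
Proof.
case: z => a b; rewrite normc_def lecR /= -[leRHS]ger0_norm ?addr_ge0 // -sqrtr_sqr.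
rewrite ler_wsqrtr // sqrrD !real_normK ?num_real // addrAC lerDl.
by rewrite mulrn_wge0 // mulr_ge0.
Qed.

Lemma cis_near1 (e : C) : 0 < e ->
  exists2 d : R, 0 < d & forall t, `|t| < d -> `|cis t - 1| < e.
Proof.
case: e => e e'; rewrite ltcE /= => /andP[/eqP -> e0].
have e20 : 0 < e / 2 by rewrite divr_gt0.
have /cvgrPdist_lt/(_ _ e20) [d1 /= d10 h1] := @continuous_cos R 0.
have /cvgrPdist_lt/(_ _ e20) [d2 /= d20 h2] := @continuous_sin R 0.
exists (Num.min d1 d2) => [|t]; first by rewrite lt_min d10.
rewrite lt_min => /andP[t1 t2].
apply: le_lt_trans (norm_leReIm _) _; rewrite -[e]/(complex.Re (e +i* 0)%C) ltcR /=.
rewrite [ltRHS]splitr oppr0 addr0.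
rewrite ltrD //.
  by have := h1 t; rewrite /= sub0r normrN cos0 distrC => ->.
by have := h2 t; rewrite /= sub0r normrN sin0 distrC subr0 => ->.
Qed.

Lemma cis_dist s t : `|cis s - cis t| = `|cis (s - t) - 1|.
Proof.
by rewrite -[RHS]mulr1 -[X in _ * X](norm_cis t) -normrM mulrBl mul1r -cisD subrK.
Qed.

Lemma nat_multiple_near (t d : R) : 0 <= t -> 0 < d ->
  exists k : nat, `|d *+ k - t| <= d.
Proof.
move=> t0 d0; exists (Num.truncn (t / d)).
have td0 : 0 <= t / d by rewrite divr_ge0 // ltW.
have /andP[h1 h2] := truncn_itv td0.
rewrite -mulr_natr distrC ger0_norm ?subr_ge0; last by rewrite mulrC -ler_pdivlMr.
move: h2; rewrite ltr_pdivrMr // -natr1 mulrDl mul1r mulrC; lra.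
Qed.

(** Pigeonhole: of the N + 1 powers z^0, ..., z^N two have angles in the same one of N arcs of
    length 2 pi / N, and their quotient is the power sought. *)
Lemma dirichlet_power (z : C) N : (0 < N)%N -> `|z| = 1 ->
  exists k d, [/\ (0 < k <= N)%N, `|d| <= pi *+ 2 / N%:R & z ^+ k = cis d].
Proof.
move=> N0 z1.
have zk k : `|z ^+ k| = 1 by rewrite normrX z1 expr1n.
have N0' : 0 < N%:R :> R by rewrite ltr0n.
have pi2 : 0 < pi *+ 2 :> R by rewrite pmulrn_lgt0 // pi_gt0.
pose a k : R := projT1 (cid2 (cis_surj (zk k))).
have aP k : 0 <= a k < pi *+ 2 by rewrite /a; case: cid2.
have aE k : cis (a k) = z ^+ k by rewrite /a; case: cid2.
pose w : R := pi *+ 2 / N%:R.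
have w0 : 0 < w by rewrite divr_gt0.
have bk k : (Num.truncn (a k / w) < N)%N.
  have /andP[a0 a1] := aP k.
  rewrite -(ltr_nat R); apply: (@le_lt_trans _ _ (a k / w)).
    by rewrite truncn_le divr_ge0 // ltW.
  by rewrite ltr_pdivrMr // /w mulrCA divff ?gt_eqF // mulr1.
pose b (i : 'I_N.+1) := Ordinal (bk i).
have /injectivePn[i [j ij eij]] : ~~ injectiveb b.
  by apply/negP => /injectiveP/leq_card; rewrite !card_ord ltnn.
wlog lij : i j ij eij / (i < j)%N.
  move=> W; move: (ij); rewrite neq_ltn => /orP[|] l; first exact: (W i j).
  by apply: (W j i) => //; rewrite eq_sym.
exists (j - i)%N, (a j - a i); split.
- by rewrite subn_gt0 lij (leq_trans (leq_subr _ _)) // -ltnS.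
- have /(congr1 val) /= e := eij.
  have h k : 0 <= a k / w by have /andP[? _] := aP k; rewrite divr_ge0 // ltW.
  have hk k : (Num.truncn (a k / w))%:R * w <= a k < (Num.truncn (a k / w))%:R * w + w.
    by have := truncn_itv (h k); rewrite ler_pdivlMr // ltr_pdivrMr // -natr1 mulrDl mul1r.
  by have := hk i; have := hk j; rewrite -/w e ler_norml; lra.
- apply: (@mulfI _ (z ^+ i)); first by rewrite -normr_eq0 zk oner_eq0.
  by rewrite -exprD subnKC ?(ltnW lij) // -!aE -cisD addrC subrK.
Qed.

Lemma roots_of_unity_dense (z e : C) : `|z| = 1 -> 0 < e ->
  exists (w : C) n, [/\ (0 < n)%N, w ^+ n = 1 & `|z - w| < e].
Proof.
move=> /cis_surj[t /andP[t0 _] <-] /cis_near1[d d0 hd].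
have pi2 : 0 < pi *+ 2 :> R by rewrite pmulrn_lgt0 // pi_gt0.
pose N := (Num.truncn (pi *+ 2 / d)).+1.
have w0 : 0 < pi *+ 2 / N%:R :> R by rewrite divr_gt0 // ltr0n.
have wd : pi *+ 2 / N%:R < d.
  rewrite ltr_pdivrMr ?ltr0n // mulrC -ltr_pdivrMr //.
  by rewrite truncnS_gt.
have [k hk] := nat_multiple_near t0 w0.
exists (cis (pi *+ 2 / N%:R *+ k)), N; split=> //.
  by rewrite -cisMn mulrnAC -[_ *+ N]mulr_natr divfK ?pnatr_eq0 // cisMn cis_2pi expr1n.
rewrite cis_dist; apply: hd; rewrite distrC; exact: le_lt_trans wd.
Qed.

(** Without a finite exponent, H contains u with u^(N!) <> 1. A Dirichlet power u^k with k <= N then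
    has a small angle, nonzero because k divides N!, and the multiples of that angle come close to
    every point. *)
Lemma dense_subgroup_circle (H : set C) :
  H `<=` [set z | `|z| = 1] -> H 1 ->
  (forall x y, H x -> H y -> H (x * y)) -> (forall x, H x -> H x^-1) ->
  (exists2 d, (0 < d)%N & forall z, H z -> z ^+ d = 1) \/
  (forall z e : C, `|z| = 1 -> 0 < e -> exists2 w, H w & `|z - w| < e).
Proof.
move=> H1 Hone HM HV; apply/or_asboolP; rewrite -implyNb; apply/implyP.
move=> /asboolP noexp; apply/asboolP.
move=> z e /cis_surj[t /andP[t0 _] <-] /cis_near1[d d0 hd].
have pi2 : 0 < pi *+ 2 :> R by rewrite pmulrn_lgt0 // pi_gt0.
have HX x n : H x -> H (x ^+ n).
  by move=> Hx; elim: n => [|n IH]; rewrite ?expr0 // exprS; exact: HM.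
pose N := (Num.truncn (pi *+ 2 / d)).+1.
have wd : pi *+ 2 / N%:R < d.
  rewrite ltr_pdivrMr ?ltr0n // mulrC -ltr_pdivrMr //.
  by rewrite truncnS_gt.
have [u Hu uN] : exists2 u, H u & u ^+ N`! != 1.
  apply: contrapT => no; apply: noexp; exists N`!; first exact: fact_gt0.
  by move=> x Hx; apply/eqP/negPn/negP => xN; apply: no; exists x.
have [k [a [/andP[k0 kN] aw uk]]] := @dirichlet_power u N isT (H1 _ Hu).
have [b [b0 bd Hb]] : exists b, [/\ 0 < b, b < d & H (cis b)].
  have a0 : a != 0.
    apply: contra uN => /eqP a0; move: uk; rewrite a0 cis0 => uk.
    have /dvdnP[q ->] : (k %| N`!)%N by rewrite dvdn_fact // k0 kN.
    by rewrite mulnC exprM uk expr1n.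
  exists `|a|; rewrite normr_gt0 a0 (le_lt_trans aw wd); split=> //.
  have Ha : H (cis a) by rewrite -uk; exact: HX.
  by case: (ger0P a) => _ //; rewrite cis_neg; exact: HV.
have [n hn] := nat_multiple_near t0 b0.
exists (cis (b *+ n)); first by rewrite cisMn; exact: HX.
rewrite cis_dist; apply: hd; rewrite distrC; exact: le_lt_trans bd.
Qed.

(** As long as the powers stay within 1/2 of 1, squaring multiplies the distance to 1 by |z + 1| >=
    3/2, so the distance grows geometrically. *)
Lemma power_far_from_one (z : C) : `|z| = 1 -> z != 1 ->
  exists n, 2^-1 <= `|z ^+ n - 1|.
Proof.
move=> z1 zn1; apply: contrapT => no.
have small n : `|z ^+ n - 1| < 2^-1.
  rewrite real_ltNge ?normr_real ?rpredV ?realn //.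
  by apply/negP => h; apply: no; exists n.
have grow n : `|z - 1| * (3 / 2) ^+ n <= `|z ^+ (2 ^ n) - 1|.
  elim: n => [|n IH]; first by rewrite expr0 mulr1 expn0 expr1.
  rewrite exprSr (mulrA `|z - 1|) expnS mulnC exprM subr_sqr_1 normrM.
  apply: ler_pM => //.
  have -> : z ^+ (2 ^ n) + 1 = 2 - (1 - z ^+ (2 ^ n)) by ring.
  apply: le_trans (lerB_dist _ _); rewrite distrC lerBrDr -lerBrDl.
  apply: le_trans (ltW (small _)) _; rewrite le_eqVlt; apply/orP; left.
  by rewrite normr_nat; apply/eqP; field.
have e0 : 0 < `|z - 1| by rewrite normr_gt0 subr_eq0.
have [e [e0' eE]] : exists e : R, 0 < e /\ `|z - 1| = e%:C%C.
  exists (complex.Re `|z - 1|); split; last by rewrite RRe_real // normr_real.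
  by move: e0; rewrite ltcE /= => /andP[].
pose n := (Num.truncn (1 / e)).+1.
have := le_lt_trans (grow n) (small _); apply/negP; rewrite -real_leNgt; last 2 first.
- by rewrite rpredV realn.
- by rewrite rpredM ?rpredX ?normr_real ?rpredM ?rpredV ?realn.
apply: le_trans (_ : e%:C%C * (n%:R / 2) <= _); last first.
  rewrite eE; apply: ler_wpM2l; first by rewrite ler0c ltW.
  by apply: le_trans (geometric_growth C n); rewrite lerDr.
have h : 1 <= e * n%:R.
  by rewrite mulrC -ler_pdivrMr // ltW // truncnS_gt.
have -> : e%:C%C * (n%:R / 2) = (e * n%:R)%:C%C / 2 :> C by rewrite mulrA rmorphM rmorph_nat.
by rewrite -[X in X <= _]mul1r ler_pM2r // -[1]/((1:R)%:C%C) lecR.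
Qed.

(** A point of infinite order on the circle, from the triple 3, 4, 5. *)
Definition nontorsion : C := (3 +i* 4)%C / 5.

Lemma norm_nontorsion : `|nontorsion| = 1.
Proof.
rewrite normrM normrV ?unitfE ?pnatr_eq0 // normr_nat normc_def /=.
have -> : 3 ^+ 2 + 4 ^+ 2 = 5 ^+ 2 :> R by ring.
by rewrite sqrtr_sqr ger0_norm // rmorph_nat divff // pnatr_eq0.
Qed.

(* The powers of 3 + 4i are congruent to 3 + 4i modulo 5, hence not real. *)
Lemma nontorsion_expr n : (0 < n)%N -> nontorsion ^+ n != 1.
Proof.
case: n => // n _; apply/eqP.
suff [a [b h]] : exists a b : int,
    (3 +i* 4)%C ^+ n.+1 = ((5 * a + 3)%:~R +i* (5 * b + 4)%:~R)%C :> C.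
  rewrite expr_div_n => /(canRL (mulfVK _)); rewrite expf_eq0 pnatr_eq0 /= => /(_ isT).
  rewrite mul1r h -natrX -(rmorph_nat (real_complex R)) => -[_ /eqP].
  by rewrite intr_eq0 => /eqP; lia.
elim: n => [|n [a [b IH]]]; first by exists 0, 0; rewrite expr1 !mulr0 !add0r.
exists (3 * a - 4 * b - 2), (3 * b + 4 * a + 4).
rewrite exprSr IH; apply/eqP; rewrite eq_complex /=; apply/andP.
by split; apply/eqP; rewrite !(intrD, intrM, intrB); ring.
Qed.

End Circle.

(** * The Stone-Weierstrass theorem *)

Section RealStoneWeierstrass.
Context (R : realType) (K : topologicalType).
Hypothesis cK : compact [set: K].
Implicit Types (f b : K -> R).

(** A Dini-type argument: the lower sections of the downward directed family [L] generate a filter,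
    and compactness makes the pointwise choice of b uniform. *)
Lemma directed_compact (L : set (K -> R)) f :
  L !=set0 -> (forall b, L b -> continuous b) -> continuous f ->
  (forall b1 b2, L b1 -> L b2 ->
     exists2 b3, L b3 & forall x, b3 x <= b1 x /\ b3 x <= b2 x) ->
  (forall x, exists2 b, L b & b x < f x) ->
  exists2 b, L b & forall x, b x < f x.
Proof.
move=> [b0 Lb0] cL cf dirL below.
pose F : set_system (K -> R) :=
  filter_from L (fun c => [set b | L b /\ forall x, b x <= c x]).
have FF : Filter F.
  apply: filter_from_filter; first by exists b0.
  move=> b1 b2 L1 L2; have [b3 L3 le3] := dirL _ _ L1 L2; exists b3 => //.
  by move=> b [Lb bb3]; split; split=> // x; apply: le_trans (bb3 x) _; case: (le3 x).
move/compact_near_coveringP: cK => /(_ _ F (fun b x => b x < f x) FF)[x _|b Lb].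
  have [b Lb bf] := below x.
  exists ([set y | b y < f y], [set c | L c /\ forall x, c x <= b x]).
    split; last by exists b.
    have cfb : {for x, continuous (f \- b)} by apply: continuousB; [exact: cf|exact: cL].
    have /cvgr_gt/(_ 0) := cfb; rewrite /= subr_gt0 => /(_ bf).
    by apply: filterS => y /=; rewrite subr_gt0.
  by move=> [y c] /= [byf [Lc cb]]; exact: le_lt_trans byf.
move=> H; exists b => // x; apply: (H b) => //.
Qed.

Lemma compact_fun_bounded f : continuous f ->
  exists2 M, 0 < M & forall x, `|f x| <= M.
Proof.
move=> cf.
have [|||||_ [n _ ->] h] := @directed_compact
    [set b | exists2 n : nat, True & b = cst (- n%:R)] (fun x => - `|f x|).
- by exists (cst (- 0%:R)), 0%N.
- by move=> _ [n _ ->]; exact: cst_continuous.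
- by move=> x; apply: cvgN; apply: cvg_norm; exact: cf.
- move=> _ _ [n _ ->] [m _ ->]; exists (cst (- (maxn n m)%:R)).
    by exists (maxn n m).
  by move=> x /=; rewrite !lerN2 !ler_nat leq_maxl leq_maxr.
- move=> x; exists (cst (- (Num.truncn `|f x|).+1%:R)); first by eexists.
  by rewrite ltrN2 truncnS_gt.
exists n.+1%:R => // x; apply: le_trans (_ : n%:R <= _); last by rewrite ler_nat.
by have := h x; rewrite /cst ltrN2 => /ltW.
Qed.

Variable A : set (K -> R).
Hypotheses (A_cont : forall a, A a -> continuous a)
  (A_cst : forall c : R, A (cst c))
  (A_add : forall a b, A a -> A b -> A (fun x => a x + b x))
  (A_mul : forall a b, A a -> A b -> A (fun x => a x * b x)).

Definition unif_closure : set (K -> R) :=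
  [set b | forall e, 0 < e -> exists2 a, A a & forall x, `|b x - a x| <= e].

Lemma sub_unif_closure : A `<=` unif_closure.
Proof. by move=> a Aa e e0; exists a => // x; rewrite subrr normr0 ltW. Qed.

Lemma unif_closure_continuous b : unif_closure b -> continuous b.
Proof.
move=> Bb x; apply/cvgrPdist_lt => e e0.
have e4 : 0 < e / 4 by rewrite divr_gt0.
have [a Aa ba] := Bb _ e4.
have /cvgrPdist_lt/(_ _ e4) := A_cont Aa (x := x).
apply: filterS => y xy.
have -> : b x - b y = (b x - a x) + (a x - a y) - (b y - a y) by ring.
have := ba x; have := ba y; have := xy.
rewrite !ltr_norml !ler_norml; lra.
Qed.

Lemma unif_closure_closed b :
  (forall e, 0 < e -> exists2 a, unif_closure a & forall x, `|b x - a x| <= e) ->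
  unif_closure b.
Proof.
move=> h e e0; have e2 : 0 < e / 2 by rewrite divr_gt0.
have [a Ba ba] := h _ e2; have [c Ac ac] := Ba _ e2; exists c => // x.
have -> : b x - c x = (b x - a x) + (a x - c x) by ring.
by rewrite [e]splitr; apply: le_trans (ler_normD _ _) _; exact: lerD.
Qed.

Lemma unif_closure_add a b : unif_closure a -> unif_closure b ->
  unif_closure (fun x => a x + b x).
Proof.
move=> Ba Bb e e0; have e2 : 0 < e / 2 by rewrite divr_gt0.
have [a' Aa aa] := Ba _ e2; have [b' Ab bb] := Bb _ e2.
exists (fun x => a' x + b' x) => [|x]; first exact: A_add.
rewrite opprD addrACA [e]splitr; apply: le_trans (ler_normD _ _) _; exact: lerD.
Qed.

Lemma unif_closure_mul a b : unif_closure a -> unif_closure b ->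
  unif_closure (fun x => a x * b x).
Proof.
move=> Ba Bb e e0.
have [M M0 aM] := compact_fun_bounded (unif_closure_continuous Ba).
have [N N0 bN] := compact_fun_bounded (unif_closure_continuous Bb).
pose d := Num.min 1 (e / (M + N + 1)).
have S0 : 0 < M + N + 1 by rewrite addr_gt0 // addr_gt0.
have d0 : 0 < d by rewrite lt_min ltr01 divr_gt0.
have d1 : d <= 1 by rewrite ge_min lexx.
have de : d * (M + N + 1) <= e by rewrite -ler_pdivlMr // ge_min lexx orbT.
have [a' Aa aa] := Ba _ d0; have [b' Ab bb] := Bb _ d0.
exists (fun x => a' x * b' x) => [|x]; first exact: A_mul.
have -> : a x * b x - a' x * b' x =
  a x * (b x - b' x) + (a x - a' x) * b x - (a x - a' x) * (b x - b' x) by ring.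
apply: le_trans (ler_normB _ _) _.
apply: le_trans (lerD (ler_normD _ _) (lexx _)) _; rewrite !normrM.
apply: le_trans de; have dd : d * d <= d by rewrite ler_piMr // ltW.
have h1 : `|a x| * `|b x - b' x| <= M * d by exact: ler_pM.
have h2 : `|a x - a' x| * `|b x| <= d * N by exact: ler_pM.
have h3 : `|a x - a' x| * `|b x - b' x| <= d * d by exact: ler_pM.
rewrite !mulrDr mulr1 [d * M]mulrC.
lra.
Qed.

Lemma unif_closure_scale c b : unif_closure b -> unif_closure (fun x => c * b x).
Proof. by apply: unif_closure_mul; exact/sub_unif_closure/A_cst. Qed.

(** The classical recursion for the square root of t^2: polynomials in t^2 that converge to |t| on
    [-1, 1]. *)
Fixpoint sqrt_approx (n : nat) (t : R) : R :=
  if n is m.+1 then sqrt_approx m t + (t ^+ 2 - sqrt_approx m t ^+ 2) / 2 else 0.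

(** The error y = |t| - p becomes y (1 - (|t| + p) / 2) <= y - y^2 / 2. As x - x^2 / 2 increases on
    [0, 1], the bound 2 / (n + 2) passes to the next one. *)
Lemma sqrt_approx_bound n (t : R) : `|t| <= 1 ->
  0 <= `|t| - sqrt_approx n t <= 2 / n.+2%:R /\ 0 <= sqrt_approx n t.
Proof.
set u := `|t| => u1; have u0 : 0 <= u by exact: normr_ge0.
have tu : t ^+ 2 = u ^+ 2 by rewrite real_normK ?num_real.
elim: n => [|n [/andP[IH0 IH1] IH2]] /=; first by split; lra.
have n0 : 0 < n.+2%:R :> R by [].
set p := sqrt_approx n t in IH0 IH1 IH2 *; set y := 2 / n.+2%:R in IH1.
have y1 : y <= 1 by rewrite ler_pdivrMr // mul1r ler_nat.
have y0 : 0 <= y by rewrite divr_ge0.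
have yn : y - y ^+ 2 / 2 <= 2 / n.+3%:R.
  rewrite -[n.+3%:R]natr1 /y; move: n0; set x : R := n.+2%:R => x0.
  have x1 : 0 < x + 1 by exact: addr_gt0.
  rewrite ler_pdivlMr //.
  have -> : (2 / x - (2 / x) ^+ 2 / 2) * (x + 1) = 2 - 2 / x ^+ 2.
    by field; rewrite lt0r_neq0.
  by rewrite gerBl divr_ge0 // exprn_ge0 // ltW.
rewrite tu; split; last nra.
apply/andP; split; first nra.
by apply: le_trans yn; nra.
Qed.

Lemma unif_closure_abs b : unif_closure b -> unif_closure (fun x => `|b x|).
Proof.
move=> Bb; have [M M0 bM] := compact_fun_bounded (unif_closure_continuous Bb).
have h : unif_closure (fun x => `|M^-1 * b x|).
  apply: unif_closure_closed => e e0.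
  pose n := Num.truncn (2 / e).
  have ne : 2 / n.+2%:R <= e.
    rewrite ler_pdivrMr // mulrC -ler_pdivrMr //.
    by apply: ltW; apply: lt_trans (truncnS_gt _) _; rewrite ltr_nat.
  exists (fun x => sqrt_approx n (M^-1 * b x)).
    elim: n {ne} => [|n IH] /=; first exact/sub_unif_closure/(A_cst 0).
    have Bs := unif_closure_scale M^-1 Bb.
    apply: unif_closure_add => //.
    have -> : (fun x => ((M^-1 * b x) ^+ 2 - sqrt_approx n (M^-1 * b x) ^+ 2) / 2) =
      (fun x => 2^-1 * (((M^-1 * b x) * (M^-1 * b x)) + (-1) *
         (sqrt_approx n (M^-1 * b x) * sqrt_approx n (M^-1 * b x)))).
      by apply/funext => x; ring.
    apply: unif_closure_scale; apply: unif_closure_add; first exact: unif_closure_mul.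
    by apply: unif_closure_scale; exact: unif_closure_mul.
  move=> x; have [|/andP[h0 h1] _] := @sqrt_approx_bound n (M^-1 * b x).
    by rewrite normrM gtr0_norm ?invr_gt0 // mulrC ler_pdivrMr // mul1r.
  by rewrite ger0_norm // (le_trans h1).
have -> : (fun x => `|b x|) = (fun x => M * `|M^-1 * b x|).
  apply/funext => x; rewrite normrM gtr0_norm ?invr_gt0 // mulrA divff ?mul1r //.
  exact: lt0r_neq0.
exact: unif_closure_scale.
Qed.

Lemma unif_closure_max a b : unif_closure a -> unif_closure b ->
  unif_closure (fun x => Num.max (a x) (b x)).
Proof.
move=> Ba Bb.
have -> : (fun x => Num.max (a x) (b x)) =
    (fun x => 2^-1 * ((a x + b x) + `|a x + (-1) * b x|)).
  by apply/funext => x; rewrite mulN1r; case: lerP; lra.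
apply: unif_closure_scale; apply: unif_closure_add; first exact: unif_closure_add.
by apply/unif_closure_abs/unif_closure_add => //; exact: unif_closure_scale.
Qed.

Lemma unif_closure_opp b : unif_closure b -> unif_closure (fun x => - b x).
Proof.
by move/(unif_closure_scale (-1)); under eq_fun do rewrite mulN1r.
Qed.

Lemma unif_closure_min a b : unif_closure a -> unif_closure b ->
  unif_closure (fun x => Num.min (a x) (b x)).
Proof.
move=> Ba Bb.
have -> : (fun x => Num.min (a x) (b x)) = (fun x => - Num.max (- a x) (- b x)).
  by apply/funext => x; rewrite oppr_max !opprK.
by apply/unif_closure_opp/unif_closure_max; exact: unif_closure_opp.
Qed.

(** Two-point interpolants exist because f is constant wherever [A] fails to separate. Minima of
    them give functions below f + e that equal f at a given point; maxima of these give one within e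
    of f. [directed_compact] makes both choices finite. *)
Theorem stone_weierstrass f : continuous f ->
  (forall x y, (forall a, A a -> a x = a y) -> f x = f y) -> unif_closure f.
Proof.
move=> cf sep.
have interp x y : exists b, [/\ unif_closure b, b x = f x & b y = f y].
  have [/sep fxy|/existsNP[a /not_implyP[Aa /eqP axy]]] :=
    pselect (forall a, A a -> a x = a y).
    by exists (cst (f x)); split=> //; exact/sub_unif_closure/A_cst.
  exists (fun z => f x + (f y - f x) / (a y - a x) * (a z + - a x)); split.
  - apply: unif_closure_add; first exact/sub_unif_closure/A_cst.
    apply/unif_closure_scale/sub_unif_closure/A_add => //; exact: A_cst.
  - by rewrite addrN mulr0 addr0.
  - by rewrite divfK ?subr_eq0 1?eq_sym // addrC subrK.
apply: unif_closure_closed => e e0.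
have fe x : f x < f x + e by rewrite ltrDl.
have upper x : exists b, [/\ unif_closure b, b x = f x & forall z, b z < f z + e].
  have [|||||b [Bb bx] bf] := @directed_compact
     [set b | unif_closure b /\ b x = f x] (fun z => f z + e).
  - by have [b [Bb bx _]] := interp x x; exists b.
  - by move=> b [/unif_closure_continuous].
  - by move=> z; apply: cvgD; [exact: cf|exact: cst_continuous].
  - move=> b1 b2 [B1 b1x] [B2 b2x]; exists (fun z => Num.min (b1 z) (b2 z)).
      by split; [exact: unif_closure_min|rewrite b1x b2x minxx].
    by move=> z; rewrite !ge_min !lexx orbT.
  - by move=> y; have [b [Bb bx by_]] := interp x y; exists b => //; rewrite by_.
  by exists b.
have [|||||b [c [Bc cf' bE]] bf] := @directed_compact
   [set b | exists c, [/\ unif_closure c, forall z, c z < f z + e & b = (fun z => - c z)]]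
   (fun z => - f z + e).
(* K may be empty, and then [upper] has no point to start from; f itself serves. *)
- have [|x] := pselect (exists x : K, True); last first.
    exists (fun z => - (f z)), f; split=> //.
    by move=> e' _; exists (cst 0) => // z; case: x; exists z.
  by move=> [x _]; have [c [Bc _ cl]] := upper x; exists (fun z => - c z), c.
- move=> _ [c [Bc _ ->]] z; apply: cvgN; exact: unif_closure_continuous.
- by move=> z; apply: cvgD; [apply: cvgN; exact: cf|exact: cst_continuous].
- move=> _ _ [c [Bc cl ->]] [d [Bd dl ->]].
  exists (fun z => - Num.max (c z) (d z)).
    exists (fun z => Num.max (c z) (d z)); split=> // [|z]; first exact: unif_closure_max.
    by rewrite gt_max cl dl.
  by move=> z; rewrite !lerN2 !le_max !lexx orbT.
- move=> x; have [c [Bc cx cl]] := upper x; exists (fun z => - c z); first by exists c.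
  by rewrite cx ltrDl.
exists c => // z; rewrite ler_norml; have := cf' z; have := bf z; rewrite bE; lra.
Qed.

End RealStoneWeierstrass.

(** * Circle-valued functions and their linear spans *)

Section Phases.
Context (R : realType) (E : dynSys).
Local Notation C := (Cx R).

Record phase := Phase { phval :> E -> C; phaseP : @circle_fun R E phval }.

HB.instance Definition _ := gen_eqMixin phase.
HB.instance Definition _ := gen_choiceMixin phase.

Lemma phase_eqP (g h : phase) : (forall x, g x = h x) <-> g = h.
Proof.
split=> [e|-> //]; case: g h e => [g Pg] [h Ph] /= /funext e.
by rewrite e in Pg *; congr Phase; exact: Prop_irrelevance.
Qed.

Lemma norm_phase (g : phase) x : `|g x| = 1.
Proof. exact: (phaseP g).2. Qed.

Lemma phase_neq0 (g : phase) x : g x != 0.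
Proof. by rewrite -normr_eq0 norm_phase oner_eq0. Qed.

Lemma phase_continuous (g : phase) : continuous g.
Proof. exact: (phaseP g).1. Qed.

Lemma circle_mul (g h : phase) : @circle_fun R E (fun x => g x * h x).
Proof.
split=> [x|x]; last by rewrite normrM !norm_phase mulr1.
by apply: cvgM; exact: phase_continuous.
Qed.

Lemma circle_inv (g : phase) : @circle_fun R E (fun x => (g x)^-1).
Proof.
split=> [x|x]; last by rewrite normfV norm_phase invr1.
by apply: cvgV; [exact: phase_neq0|exact: phase_continuous].
Qed.

Lemma circle_cst (z : C) : `|z| = 1 -> @circle_fun R E (fun=> z).
Proof. by move=> z1; split=> // x; exact: cst_continuous. Qed.

Definition phase_add (g h : phase) := Phase (circle_mul g h).
Definition phase_opp (g : phase) := Phase (circle_inv g).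
Definition phase_zero := Phase (circle_cst (@normr1 C)).

Lemma phase_addA : associative phase_add.
Proof. by move=> g h k; apply/phase_eqP => x /=; rewrite mulrA. Qed.
Lemma phase_addC : commutative phase_add.
Proof. by move=> g h; apply/phase_eqP => x /=; rewrite mulrC. Qed.
Lemma phase_add0 : left_id phase_zero phase_add.
Proof. by move=> g; apply/phase_eqP => x /=; rewrite mul1r. Qed.
Lemma phase_addN : left_inverse phase_zero phase_opp phase_add.
Proof. by move=> g; apply/phase_eqP => x /=; rewrite mulVf ?phase_neq0. Qed.

(* The multiplicative group of continuous circle-valued functions is written
   additively, so that translations act on it by additive maps. *)
HB.instance Definition _ :=
  GRing.isZmodule.Build phase phase_addA phase_addC phase_add0 phase_addN.

Lemma phaseD (g h : phase) x : (g + h) x = g x * h x. Proof. by []. Qed.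
Lemma phaseN (g : phase) x : (- g) x = (g x)^-1. Proof. by []. Qed.
Lemma phase0 x : (0 : phase) x = 1. Proof. by []. Qed.
Lemma phaseB (g h : phase) x : (g - h) x = g x / h x. Proof. by []. Qed.
Lemma phaseMn (g : phase) n x : (g *+ n) x = g x ^+ n.
Proof. by elim: n => [|n IH]; rewrite ?mulr0n ?expr0 // mulrS phaseD IH exprS. Qed.

(** Lists of coefficient-phase pairs instead of indexed families, so that adding combinations is
    concatenation. *)
Definition tspan (S : set phase) : set (E -> C) :=
  [set h | exists s : seq (C * phase), (forall p, p \in s -> S p.2) /\
     h = fun x => \sum_(p <- s) p.1 * p.2 x].

Definition approximable (S : set phase) : set (E -> C) :=
  [set f | forall e : C, 0 < e -> exists2 h, tspan S h & forall x, `|f x - h x| < e].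

Lemma tspan0 S : tspan S (fun=> 0).
Proof. by exists [::]; split=> //; apply/funext => x; rewrite big_nil. Qed.

Lemma tspan_gen (S : set phase) (c : C) (g : phase) : S g -> tspan S (fun x => c * g x).
Proof.
move=> Sg; exists [:: (c, g)]; split=> [p|]; first by rewrite inE => /eqP ->.
by apply/funext => x; rewrite big_seq1.
Qed.

Lemma tspan_add S h k : tspan S h -> tspan S k -> tspan S (fun x => h x + k x).
Proof.
move=> [s [Ss ->]] [t [St ->]]; exists (s ++ t); split=> [p|].
  by rewrite mem_cat => /orP[/Ss|/St].
by apply/funext => x; rewrite big_cat.
Qed.

Lemma tspan_sum S (I : eqType) (r : seq I) (h : I -> E -> C) :
  (forall i, i \in r -> tspan S (h i)) -> tspan S (fun x => \sum_(i <- r) h i x).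
Proof.
elim: r => [|i r IH] Sh.
  by under eq_fun do rewrite big_nil; exact: tspan0.
under eq_fun do rewrite big_cons.
apply: tspan_add; first by apply: Sh; rewrite mem_head.
by apply: IH => j jr; apply: Sh; rewrite in_cons jr orbT.
Qed.

Lemma tspan_scale S c h : tspan S h -> tspan S (fun x => c * h x).
Proof.
move=> [s [Ss ->]]; under eq_fun do rewrite mulr_sumr.
apply: tspan_sum => p ps; under eq_fun do rewrite mulrA.
exact/tspan_gen/Ss.
Qed.

Lemma tspan_sub (S S' : set phase) h :
  (forall g, S g -> tspan S' g) -> tspan S h -> tspan S' h.
Proof.
move=> SS' [s [Ss ->]]; apply: tspan_sum => p ps.
exact/tspan_scale/SS'/Ss.
Qed.

Lemma tspan_mono (S S' : set phase) : S `<=` S' -> tspan S `<=` tspan S'.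
Proof.
move=> SS' h; apply: tspan_sub => g /SS' Sg.
by have := @tspan_gen S' 1 g Sg; under eq_fun do rewrite mul1r.
Qed.

Lemma tspan_mul (S : set phase) h k : (forall f g, S f -> S g -> S (f + g)) ->
  tspan S h -> tspan S k -> tspan S (fun x => h x * k x).
Proof.
move=> SD [s [Ss ->]] [t [St ->]].
under eq_fun do rewrite mulr_suml.
apply: tspan_sum => p ps; under eq_fun do rewrite mulr_sumr.
apply: tspan_sum => q qt.
have -> : (fun x => p.1 * p.2 x * (q.1 * q.2 x)) =
    (fun x => (p.1 * q.1) * (p.2 + q.2) x).
  by apply/funext => x; rewrite phaseD mulrACA.
by apply/tspan_gen/SD; [exact: Ss|exact: St].
Qed.

Lemma tspan_continuous S h : tspan S h -> continuous h.
Proof.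
move=> [s [_ ->]]; elim: s => [|p s IH].
  by under eq_fun do rewrite big_nil; exact: cst_continuous.
under eq_fun do rewrite big_cons.
move=> x.
apply: cvgD; last exact: IH.
by apply: cvgM; [exact: cvg_cst|exact: phase_continuous].
Qed.

End Phases.

(** * The complex Stone-Weierstrass theorem and quasi-discrete spectrum *)

Section ComplexStoneWeierstrass.
Context (R : realType) (E : dynSys).
Local Notation C := (Cx R).

Lemma contraction_continuous (p : C -> R) :
  (forall z w : C, (`|p z - p w|%:C%C : C) <= `|z - w|) -> continuous p.
Proof.
move=> hp z; have Fz : Filter (nbhs z) by exact: nbhs_filter.
apply/cvgrPdist_lt => e e0.
have e0' : 0 < e%:C%C :> C by rewrite ltcR.
have /cvgrPdist_lt/(_ _ e0') : (fun w : C => w) w @[w --> z] --> z by exact: cvg_id.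
by apply: filterS => w /=; rewrite -ltcR; apply: le_lt_trans.
Qed.

Lemma complex_Re_continuous : continuous (@complex.Re R : C -> R).
Proof.
apply: contraction_continuous => z w.
by have := normc_ge_Re (z - w : R[i]); case: z w => a b [c d].
Qed.

Lemma complex_Im_continuous : continuous (@complex.Im R : C -> R).
Proof.
apply: contraction_continuous => z w.
have := normc_ge_Re ((z - w) * 'i%C : R[i]).
by rewrite normrM ReiNIm normrN [`|'i%C|]normc_def /= expr0n expr1n add0r sqrtr1 mulr1;
  case: z w => a b [c d].
Qed.

(** The real functions in the span form an algebra to which the real theorem applies. The conjugate
    of a phase is its inverse, so real and imaginary parts of elements of [S] lie in the span. *)
Lemma complex_stone_weierstrass (S : set (phase R E)) f :
  S 0 -> (forall g h, S g -> S h -> S (g - h)) -> continuous f ->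
  (forall x y, (forall g, S g -> g x = g y) -> f x = f y) -> approximable S f.
Proof.
move=> S0 SB cf sep.
have SN g : S g -> S (- g) by move=> Sg; rewrite -sub0r; exact: SB.
have SD g h : S g -> S h -> S (g + h).
  by move=> Sg Sh; rewrite -[h]opprK; apply: SB => //; exact: SN.
pose A : set (E -> R) := [set a | tspan S (fun x => (a x)%:C%C)].
have A_cont a : A a -> continuous a.
  move=> /tspan_continuous ca x.
  apply: (@continuous_comp E C R (fun x => (a x)%:C%C) (@complex.Re R)); first exact: ca.
  exact: complex_Re_continuous.
have A_cst c : A (cst c).
  have := @tspan_gen R E S c%:C%C 0 S0.
  by under eq_fun do rewrite phase0 mulr1.
have A_add a b : A a -> A b -> A (fun x => a x + b x).
  move=> Aa Ab; have := tspan_add Aa Ab; rewrite /A /=.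
  by under [X in _ -> tspan _ X]eq_fun do rewrite rmorphD.
have A_mul a b : A a -> A b -> A (fun x => a x * b x).
  move=> Aa Ab; have := tspan_mul SD Aa Ab; rewrite /A /=.
  by under [X in _ -> tspan _ X]eq_fun do rewrite rmorphM.
have conjE (g : phase R E) x : (g x)^*%C = (- g) x.
  by rewrite phaseN invc_norm norm_phase expr1n invr1 mul1r.
have A_Re (g : phase R E) : S g -> A (fun x => complex.Re (g x)).
  move=> Sg; have h : tspan S (fun x => 2^-1 * g x + 2^-1 * (- g) x).
    by apply: tspan_add; apply: tspan_gen => //; exact: SN.
  rewrite /A /=; under eq_fun do rewrite ReJ_add conjE mulrC mulrDr; exact: h.
have A_Im (g : phase R E) : S g -> A (fun x => complex.Im (g x)).
  move=> Sg; have h : tspan S (fun x => (2^-1 * 'i%C) * (- g) x + (- (2^-1 * 'i%C)) * g x).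
    by apply: tspan_add; apply: tspan_gen => //; exact: SN.
  rewrite /A /=; have -> // : (fun x => (complex.Im (g x))%:C%C) =
    (fun x => (2^-1 * 'i%C) * (- g) x + (- (2^-1 * 'i%C)) * g x).
  by apply/funext => x; rewrite ImJ_sub conjE mulNr -mulrBr -mulrA mulrC.
have sepA (p : C -> R) x y : (forall a, A a -> a x = a y) -> p (f x) = p (f y).
  move=> Axy; congr p; apply: sep => g Sg; apply/eqP; rewrite eq_complex.
  by rewrite (Axy _ (A_Re _ Sg)) (Axy _ (A_Im _ Sg)) !eqxx.
have cRe : continuous (fun x => complex.Re (f x)).
  by move=> x; apply: continuous_comp; [exact: cf|exact: complex_Re_continuous].
have cIm : continuous (fun x => complex.Im (f x)).
  by move=> x; apply: continuous_comp; [exact: cf|exact: complex_Im_continuous].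
have Bu := stone_weierstrass (@ds_compact E) A_cont A_cst A_add A_mul cRe (sepA _).
have Bv := stone_weierstrass (@ds_compact E) A_cont A_cst A_add A_mul cIm (sepA _).
case=> e e'; rewrite ltcE /= => /andP[/eqP -> e0].
have e4 : 0 < e / 4 by rewrite divr_gt0.
have [a Aa ua] := Bu _ e4; have [b Ab vb] := Bv _ e4.
exists (fun x => (a x)%:C%C + 'i%C * (b x)%:C%C).
  by apply: tspan_add => //; exact: tspan_scale.
move=> x; apply: le_lt_trans (norm_leReIm _) _.
have -> : (e +i* 0)%C = e%:C%C by []; rewrite ltcR.
have -> : f x - ((a x)%:C%C + 'i%C * (b x)%:C%C) =
   ((complex.Re (f x) - a x) +i* (complex.Im (f x) - b x))%C.
  by case: (f x) => u v; apply/eqP; rewrite eq_complex /=; apply/andP; split; apply/eqP; ring.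
by have /= := ua x; have /= := vb x; lra.
Qed.

Lemma lin_span_tspan (S : set (E -> C)) (h : E -> C) :
  (forall g, S g -> @circle_fun R E g) ->
  lin_span S h <-> tspan [set p : phase R E | S p] h.
Proof.
move=> Scirc; split=> [[n [c [g [Sg hE]]]]|[s [Ss ->]]].
  have -> : h = fun x => \sum_(i <- index_enum 'I_n) c i * Phase (Scirc _ (Sg i)) x.
    by apply/funext => x; rewrite hE.
  apply: tspan_sum => i _; apply: (@tspan_gen _ _ _ (c i) (Phase (Scirc _ (Sg i)))).
  exact: Sg.
exists (size s), (fun i => (tnth (in_tuple s) i).1), (fun i => (tnth (in_tuple s) i).2).
by split=> [i|x]; [apply: Ss; exact: mem_tnth|rewrite [LHS]big_tnth].
Qed.

Lemma quasi_eigen_circle m (g : E -> C) :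
  quasi_eigen m g -> @circle_fun R E g.
Proof. by case: m => [[c c1 ->]|m []] //; exact: circle_cst. Qed.

Lemma qdsP : quasi_discrete_spectrum R E <->
  forall f : E -> C, continuous f ->
    approximable [set p : phase R E | exists m, @quasi_eigen R E m p] f.
Proof.
have Scirc (g : E -> C) : @quasi_eigen_all R E g -> @circle_fun R E g.
  by case=> m _ /quasi_eigen_circle.
have SE : [set p : phase R E | exists m, @quasi_eigen R E m p] =
    [set p : phase R E | @quasi_eigen_all R E p].
  by apply/seteqP; split=> p [m]; exists m.
split=> [qds f cf e e0|H f cf B].
  have [|h [hS hB]] := qds f cf [set h | forall x, `|f x - h x| < e].
    apply/uniform_nbhs; exists [set xy : C * C | `|xy.1 - xy.2| < e]; split.
      by rewrite -entourage_ballE; exists e => // -[x y] /=; rewrite -ball_normE.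
    by move=> g h x; exact: h.
  by exists h => //; rewrite SE; apply/lin_span_tspan.
move=> /uniform_nbhs[U [entU UB]].
move: entU; rewrite -entourage_ballE => -[e /= e0 eU].
have [h hS fh] := H f cf e e0.
exists h; split; first by apply/lin_span_tspan => //; rewrite -SE.
by apply: UB => x _; apply: eU; rewrite /= -ball_normE; exact: fh.
Qed.

End ComplexStoneWeierstrass.

(** * Quasi-eigenfunctions on an enveloping semigroup *)

Lemma closed_agree (X Y : topologicalType) (f g : X -> Y) :
  hausdorff_space Y -> continuous f -> continuous g -> closed [set x | f x = g x].
Proof.
move=> hY cf cg x clx; apply: hY => A B nA nB.
have nA' : nbhs x (f @^-1` A) by exact: cf.
have nB' : nbhs x (g @^-1` B) by exact: cg.
have [y [fgy [Ay By]]] := clx _ (filterI nA' nB').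
by exists (f y); split=> //; rewrite fgy.
Qed.

Lemma closed_forall (T : topologicalType) (I : Type) (P : I -> set T) :
  (forall i, closed (P i)) -> closed [set x | forall i, P i x].
Proof.
move=> cP; have -> : [set x | forall i, P i x] = \bigcap_(i in setT) P i.
  by apply/seteqP; split=> x h i; [move=> _|]; apply: h.
by apply: closed_bigI => i _; exact: cP.
Qed.

Lemma closed_imply (T : topologicalType) (Q : Prop) (P : set T) :
  closed P -> closed [set x | Q -> P x].
Proof.
move=> cP x clx q; apply: cP => B nB; have [y [Py By]] := clx B nB.
by exists y; split=> //; exact: Py.
Qed.

(* Only right multiplications are continuous in an enveloping semigroup. The
   density of the orbit of e is stated as an induction principle for closed
   sets. *)
Record is_ellis (E : dynSys) (mul : E -> E -> E) (e : E) : Prop := IsEllis {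
  ellis_mulA : forall x y z, mul x (mul y z) = mul (mul x y) z;
  ellis_mul1x : forall x, mul e x = x;
  ellis_mulx1 : forall x, mul x e = x;
  ellis_continuous : forall a, continuous (mul^~ a);
  ellis_map : forall x y, ds_map (mul x y) = mul (ds_map x) y;
  ellis_dense : forall P : set E, closed P -> P e ->
    (forall x, P x -> P (ds_map x)) -> (forall x, P x -> P (ds_inv x)) ->
    forall x, P x }.

Section Translations.
Context (R : realType) (E : dynSys) (mul : E -> E -> E) (e : E).
Hypothesis HE : is_ellis mul e.
Local Notation C := (Cx R).
Local Notation U := (phase R E).
Local Notation se := (ds_map e).

Let mulA := ellis_mulA HE.
Let mul1x := ellis_mul1x HE.
Let mulx1 := ellis_mulx1 HE.

Lemma mul_map_l x : mul se x = ds_map x.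
Proof. by rewrite -(ellis_map HE) mul1x. Qed.

Lemma ellis_inv x y : ds_inv (mul x y) = mul (ds_inv x) y.
Proof. by rewrite -{1}(ds_invK x) -(ellis_map HE) ds_mapK. Qed.

(** The condition is closed in x and holds along the orbit of e. With [mul_map_l] it makes the
    generator [se] central. *)
Lemma mul_map_r x : mul x se = ds_map x.
Proof.
apply: (ellis_dense HE (P := [set x | mul x se = ds_map x])) => //= [|y IH|y IH].
- apply: closed_agree; [exact: ds_hausdorff|exact: (ellis_continuous HE)|].
  exact: ds_map_continuous.
- by rewrite -(ellis_map HE) IH.
- by rewrite -ellis_inv IH ds_mapK ds_invK.
Qed.

Lemma phase_ind (P : set E) : closed P -> P e ->
  (forall x, P x -> P (mul x se)) -> (forall x, P (mul x se) -> P x) ->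
  forall x, P x.
Proof.
move=> cP Pe P1 P2; apply: (ellis_dense HE) => // x Px; first by rewrite -mul_map_r; exact: P1.
by apply: P2; rewrite mul_map_r ds_invK.
Qed.

Lemma C_hausdorff : hausdorff_space C.
Proof. exact: norm_hausdorff. Qed.

Lemma phase_level_closed (g : U) (z : C) : closed [set x | g x = z].
Proof.
apply: closed_agree; [exact: C_hausdorff|exact: phase_continuous|].
by move=> x; exact: cst_continuous.
Qed.

Lemma trans_circle a (g : U) : @circle_fun R E (fun x => g (mul x a)).
Proof.
split=> [x|x]; last exact: norm_phase.
apply: (@continuous_comp E E C (mul^~ a) g); first exact: (ellis_continuous HE).
exact: phase_continuous.
Qed.

Definition translate a (g : U) : U := Phase (trans_circle a g).
Local Notation trans := translate.

Lemma trans_sub a : zmod_morphism (trans a).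
Proof. by move=> g h; apply/phase_eqP. Qed.
HB.instance Definition _ a := GRing.isZmodMorphism.Build U U (trans a) (trans_sub a).

Lemma transE a g x : trans a g x = g (mul x a). Proof. by []. Qed.

Lemma transB a g h : trans a (g - h) = trans a g - trans a h.
Proof. exact: raddfB. Qed.

Lemma transD a g h : trans a (g + h) = trans a g + trans a h.
Proof. exact: raddfD. Qed.

Lemma trans0 a : trans a 0 = 0.
Proof. exact: raddf0. Qed.

Lemma transMn a g n : trans a (g *+ n) = trans a g *+ n.
Proof. exact: raddfMn. Qed.

Lemma trans_mul a b g : trans (mul a b) g = trans a (trans b g).
Proof. by apply/phase_eqP => x; rewrite !transE mulA. Qed.

Lemma trans1 g : trans e g = g.
Proof. by apply/phase_eqP => x; rewrite transE mulx1. Qed.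

Lemma trans_comm_map a g : trans a (trans se g) = trans se (trans a g).
Proof. by rewrite -!trans_mul mul_map_l mul_map_r. Qed.

(** Multiplicatively, x |-> g(xa) / g(x). For a = [se] this is the difference operator D of the
    system, and [D g = 0] is the way to say that g is constant. *)
Definition tdiff a (g : U) : U := trans a g - g.
Local Notation del := tdiff.

Lemma del_sub a : zmod_morphism (del a).
Proof. by move=> g h; rewrite /tdiff transB !opprD addrACA. Qed.
HB.instance Definition _ a := GRing.isZmodMorphism.Build U U (del a) (del_sub a).

Lemma delB a g h : del a (g - h) = del a g - del a h.
Proof. exact: raddfB. Qed.

Lemma delMn a g n : del a (g *+ n) = del a g *+ n.
Proof. exact: raddfMn. Qed.

Lemma del0 a : del a 0 = 0.
Proof. exact: raddf0. Qed.

Lemma trans_del a g : trans a g = del a g + g.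
Proof. by rewrite /tdiff subrK. Qed.

Lemma del_eq0 a g : del a g = 0 <-> trans a g = g.
Proof. by rewrite /tdiff; split=> [/eqP|->]; rewrite ?subrr // subr_eq0 => /eqP. Qed.

Local Notation D := (del se).

Lemma D_trans a g : D (trans a g) = trans a (D g).
Proof. by rewrite /tdiff transB trans_comm_map. Qed.

Lemma D_del a g : D (del a g) = del a (D g).
Proof. by rewrite [del a g]/tdiff [del a (D g)]/tdiff delB D_trans. Qed.

Definition tdiff_iter n (g : U) : U := iter n D g.
Local Notation Dn := tdiff_iter.

Lemma Dn_sub n : zmod_morphism (Dn n).
Proof. by elim: n => [|n IH] g h //=; rewrite IH delB. Qed.
HB.instance Definition _ n := GRing.isZmodMorphism.Build U U (Dn n) (Dn_sub n).

Lemma DnB n g h : Dn n (g - h) = Dn n g - Dn n h.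
Proof. exact: raddfB. Qed.

Lemma DnMn n d g : Dn n (g *+ d) = Dn n g *+ d.
Proof. exact: raddfMn. Qed.

Lemma Dn0 n : Dn n 0 = 0.
Proof. exact: raddf0. Qed.

Lemma DnS n g : Dn n.+1 g = D (Dn n g). Proof. by []. Qed.
Lemma DnSr n g : Dn n.+1 g = Dn n (D g). Proof. exact: iterSr. Qed.
Lemma Dn_add m n g : Dn (m + n) g = Dn m (Dn n g). Proof. exact: iterD. Qed.

Lemma Dn_trans n a g : Dn n (trans a g) = trans a (Dn n g).
Proof. by elim: n => [|n IH] //=; rewrite IH D_trans. Qed.

Lemma Dn_del n a g : Dn n (del a g) = del a (Dn n g).
Proof. by elim: n => [|n IH] //=; rewrite IH D_del. Qed.

Lemma D_eq0 g : D g = 0 <-> forall x, g x = g e.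
Proof.
split=> [/del_eq0 Dg|gc]; last by apply/del_eq0/phase_eqP => x; rewrite transE gc [RHS]gc.
apply: (phase_ind (P := [set x | g x = g e])) => // [|x|x].
- exact: phase_level_closed.
- by rewrite /= -{1}Dg.
- by rewrite /= -transE Dg.
Qed.

Lemma D_eq0_trans a g : D g = 0 -> trans a g = g.
Proof. by move=> /D_eq0 gc; apply/phase_eqP => x; rewrite transE gc [RHS]gc. Qed.

Lemma D_eq0_del a g : D g = 0 -> del a g = 0.
Proof. by move/(D_eq0_trans a)/del_eq0. Qed.

Lemma const_eq g h : D g = 0 -> D h = 0 -> g e = h e -> g = h.
Proof. by move=> /D_eq0 gc /D_eq0 hc gh; apply/phase_eqP => x; rewrite gc gh hc. Qed.

Lemma const_eq0 g : D g = 0 -> g e = 1 -> g = 0.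
Proof. by move=> Dg ge; apply: const_eq => //; rewrite del0. Qed.

(** As for polynomials: m + 1 successive differences vanish. [quasi_eigenE] identifies these with
    the quasi-eigenfunctions of order m. *)
Definition degree_le m : set U := [set g | Dn m.+1 g = 0].
Local Notation G := degree_le.

Definition quasi_phase : set U := [set g | exists m, G m g].
Local Notation Gall := quasi_phase.

Lemma GE m g : G m g = (Dn m.+1 g = 0). Proof. by []. Qed.

Lemma G_D m g : G m.+1 g <-> G m (D g).
Proof. by rewrite !GE DnSr. Qed.

Lemma quasi_eigenE m (g : U) : quasi_eigen m g <-> G m g.
Proof.
elim: m g => [|m IH] g /=.
  split=> [[c c1 gc]|/D_eq0 gc]; first by apply/D_eq0 => x; rewrite gc.
  by exists (g e); [exact: norm_phase|apply/funext].
split=> [[_ [f fm gf]]|Dg].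
  apply/G_D/IH.
  suff -> : (D g : E -> C) = f by [].
  apply/funext => x; rewrite /tdiff phaseB transE mul_map_r gf mulfK //.
  exact: phase_neq0.
split; first exact: phaseP.
exists (D g); first exact/IH/G_D.
by move=> x; rewrite /tdiff phaseB transE mul_map_r divfK // phase_neq0.
Qed.

Lemma G_0 m : G m 0. Proof. by rewrite !GE Dn0. Qed.

Lemma G_sub m g h : G m g -> G m h -> G m (g - h).
Proof. by rewrite !GE DnB => -> ->; rewrite subrr. Qed.

Lemma G_mono m n g : (m <= n)%N -> G m g -> G n g.
Proof.
by move=> mn; rewrite !GE => h; rewrite -(subnK mn) -addnS Dn_add h Dn0.
Qed.

Lemma G_muln m g d : G m g -> G m (g *+ d).
Proof. by rewrite !GE DnMn => ->; rewrite mul0rn. Qed.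

Lemma G_trans m a g : G m g -> G m (trans a g).
Proof. by rewrite !GE Dn_trans => ->; rewrite trans0. Qed.

(** [del a] commutes with D and kills constants. This is the unipotence of all translations, not
    only of that by the generator. *)
Lemma G_del m a g : G m.+1 g -> G m (del a g).
Proof. by rewrite !GE Dn_del => h; exact: D_eq0_del. Qed.

Lemma G_del0 a g : G 0 g -> del a g = 0.
Proof. exact: D_eq0_del. Qed.

Lemma Gall_sub g h : Gall g -> Gall h -> Gall (g - h).
Proof.
move=> [m gm] [n hn]; exists (maxn m n).
by apply: G_sub; [apply: G_mono gm|apply: G_mono hn]; rewrite ?leq_maxl ?leq_maxr.
Qed.

Lemma Gall_del a g : Gall g -> Gall (del a g).
Proof. by move=> [m gm]; exists m; apply: G_del; exact: G_mono gm. Qed.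

Lemma Gall_trans a g : Gall g -> Gall (trans a g).
Proof. by move=> [m gm]; exists m; exact: G_trans. Qed.

Lemma Gall_Dn n g : Gall g -> Gall (Dn n g).
Proof. by move=> h; elim: n => [|n] //=; exact: Gall_del. Qed.

(* For g = e(p), with p a real polynomial: the coefficients of p in degrees
   above m are rational. *)
Definition degree_le_tors m : set U :=
  [set g | Gall g /\ exists2 d, (0 < d)%N & G m (g *+ d)].
Local Notation S := degree_le_tors.

Lemma S_G m g : G m g -> S m g.
Proof. by move=> gm; split; [exists m|exists 1%N]. Qed.

Lemma S_0 m : S m 0. Proof. exact/S_G/G_0. Qed.

Lemma S_sub m g h : S m g -> S m h -> S m (g - h).
Proof.
move=> [Gg [d d0 gd]] [Gh [c c0 hc]]; split; first exact: Gall_sub.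
exists (d * c)%N; first by rewrite muln_gt0 d0.
by rewrite mulrnBl mulrnA mulnC mulrnA; apply: G_sub; exact: G_muln.
Qed.

Lemma S_opp m g : S m g -> S m (- g).
Proof. by move=> gm; rewrite -sub0r; apply: S_sub => //; exact: S_0. Qed.

Lemma S_add m g h : S m g -> S m h -> S m (g + h).
Proof. by move=> gm hm; rewrite -[h]opprK; apply: S_sub => //; exact: S_opp. Qed.

Lemma S_mono m n g : (m <= n)%N -> S m g -> S n g.
Proof. by move=> mn [? [d d0 gd]]; split=> //; exists d => //; exact: G_mono gd. Qed.

Lemma S_torsion m g d : (0 < d)%N -> Gall g -> S m (g *+ d) -> S m g.
Proof.
move=> d0 Gg [_ [c c0 gc]]; split=> //; exists (d * c)%N; last by rewrite mulrnA.
by rewrite muln_gt0 d0.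
Qed.

Lemma S_Dn n m g : Gall g -> S (n + m) g <-> S m (Dn n g).
Proof.
move=> Gg; split=> [[_ [d d0]]|[_ [d d0]]].
  rewrite !GE -addnS addnC Dn_add => h; split; first exact: Gall_Dn.
  by exists d => //; rewrite -DnMn.
rewrite -DnMn !GE -Dn_add addnC => h; split=> //; exists d => //.
by rewrite !GE -addnS.
Qed.

Lemma S_D m g : S m.+1 g -> S m (D g).
Proof. by move=> h; apply/(@S_Dn 1 m g) => //; case: h. Qed.

Lemma S_trans m a g : S m g -> S m (trans a g).
Proof.
move=> [Gg [d d0 gd]]; split; first exact: Gall_trans.
by exists d => //; rewrite -transMn; exact: G_trans.
Qed.

Lemma S_del m a g : S m.+1 g -> S m (del a g).
Proof.
move=> [Gg [d d0 gd]]; split; first exact: Gall_del.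
by exists d => //; rewrite -delMn; exact: G_del.
Qed.

Lemma Gall_S g : Gall g -> exists m, S m g.
Proof. by move=> [m gm]; exists m; exact: S_G. Qed.

Definition degree_stab m : set E := [set a | forall g, S m g -> trans a g = g].
Local Notation Fix := degree_stab.

Lemma Fix_mul m a b : Fix m a -> Fix m b -> Fix m (mul a b).
Proof. by move=> am bm g gm; rewrite trans_mul bm // am. Qed.

(** D g has degree m modulo torsion, and translation commutes with D. So an element that fixes
    degree m multiplies each phase of degree m + 1 by a constant. *)
Lemma Fix_del m a g : Fix m a -> S m.+1 g -> D (del a g) = 0.
Proof. by move=> am gm; rewrite D_del; apply/del_eq0/am/S_D. Qed.

(** Some multiple d g is constant, so [del a g] is d-torsion. By induction on the degree it has a
    period q under a; the change Y of g over q steps is then a-invariant and d-torsion, and g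
    returns after q d steps. *)
Lemma S0_periodic a g : S 0 g -> exists2 q, (0 < q)%N & iter q (trans a) g = g.
Proof.
move=> [[M gM] [d d0 gd]].
have : (del a g) *+ d = 0 by rewrite -delMn; exact: G_del0.
have iterB q x y : iter q (trans a) (x - y) = iter q (trans a) x - iter q (trans a) y.
  by elim: q => [|q IH] //=; rewrite IH transB.
suff H : forall M x, G M x -> (del a x) *+ d = 0 ->
    exists2 q, (0 < q)%N & iter q (trans a) x = x by exact: H gM.
elim=> [|{}M IH] {}g {gM gd} gM gd; first by exists 1%N => //=; exact/del_eq0/G_del0.
have [q q0 Yq] : exists2 q, (0 < q)%N & iter q (trans a) (del a g) = del a g.
  by apply: IH; [exact: G_del|rewrite -delMn gd del0].
pose Y := iter q (trans a) g - g.
have aY : trans a Y = Y.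
  apply/del_eq0; rewrite /Y delB /=.
  suff -> : del a (iter q (trans a) g) = iter q (trans a) (del a g) by rewrite Yq subrr.
  by rewrite /tdiff iterB -iterS iterSr.
have Yd : Y *+ d = 0.
  have Yj j : (iter j (trans a) g - g) *+ d = 0.
    elim: j => [|j IHj] /=; first by rewrite subrr mul0rn.
    have -> : trans a (iter j (trans a) g) - g =
        trans a (iter j (trans a) g - g) + del a g by rewrite transB /tdiff addrA subrK.
    by rewrite mulrnDl -transMn IHj trans0 gd addr0.
  exact: Yj.
exists (q * d)%N; first by rewrite muln_gt0 q0.
have Yk k : iter (q * k) (trans a) g = g + Y *+ k.
  elim: k => [|k IHk]; first by rewrite muln0 mulr0n addr0.
  have iterYk j : iter j (trans a) (g + Y *+ k) = iter j (trans a) g + Y *+ k.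
    by elim: j => [|j IHj] //=; rewrite IHj transD transMn aY.
  by rewrite mulnS iterD IHk iterYk mulrS addrA /Y [g + _]addrC subrK.
by rewrite Yk Yd addr0.
Qed.

End Translations.

(** * Idempotents and the group structure *)

Lemma compact_directed_inter (T : topologicalType) (F : set (set T)) :
  compact [set: T] -> F !=set0 -> (forall A, F A -> closed A /\ A !=set0) ->
  (forall A B, F A -> F B -> exists2 D, F D & D `<=` A `&` B) ->
  exists p, forall A, F A -> A p.
Proof.
move=> cT [A0 FA0] FP Fdir.
pose H : set_system T := filter_from F id.
have PH : ProperFilter H.
  apply: filter_from_proper; last by move=> A /FP[].
  apply: filter_from_filter; first by exists A0.
  by move=> A B FA FB; have [D FD DAB] := Fdir _ _ FA FB; exists D.
have [p [_ clp]] := cT H PH filterT.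
exists p => A FA; apply: (FP A FA).1 => B nB.
by apply: clp => //; exists A.
Qed.

Section GroupStructure.
Context (R : realType) (E : dynSys) (mul : E -> E -> E) (e : E).
Hypothesis HE : is_ellis mul e.
Local Notation C := (Cx R).
Local Notation se := (ds_map e).
Local Notation Gt := (@quasi_phase R E mul e HE).
Local Notation Sm := (@degree_le_tors R E mul e HE).
Local Notation Fx := (@degree_stab R E mul e HE).
Local Notation trans := (@translate R E mul e HE).

Let mulA := ellis_mulA HE.
Let mul1x := ellis_mul1x HE.
Let mulx1 := ellis_mulx1 HE.

(** Zorn and compactness give a minimal closed subsemigroup B. For x in B, minimality yields B x = B
    and then { y in B | y x = x } = B, so x is idempotent; both sets are closed because right
    multiplications are continuous. *)
Lemma ellis_numakura (A : set E) : closed A -> A !=set0 ->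
  (forall x y, A x -> A y -> A (mul x y)) -> exists2 u, A u & mul u u = u.
Proof.
move=> cA [a0 Aa0] AM.
pose P (B : set E) := [/\ closed B, B !=set0, (forall x y, B x -> B y -> B (mul x y))
  & B `<=` A].
pose T := {B : set E | P B}.
(* Reverse inclusion, so that a maximal element for Zorn is minimal for inclusion. *)
pose le (B D : T) : bool := `[< sval D `<=` sval B >].
have PA : P A by split=> //; exists a0.
have [|B D F|B D|F Ftot|[B PB] Bmin] := @Zorn T le.
- by move=> B; apply/asboolP.
- by move=> /asboolP BD /asboolP DF; apply/asboolP => x /DF/BD.
- case: B D => [B PB] [D PD] /asboolP /= BD /asboolP /= DB.
  by apply: eq_exist; apply/seteqP; split.
- have [[B0 FB0]|F0] := pselect (F !=set0); last first.
    by exists (exist P A PA) => B FB; case: F0; exists B.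
  pose I := [set x | forall B, F B -> sval B x].
  have PI : P I.
    split.
    - have -> : I = \bigcap_(B in F) sval B by apply/seteqP; split.
      by apply: closed_bigI => B _; case: (svalP B).
    - have [|||p hp] := @compact_directed_inter E (sval @` F) (@ds_compact E).
      + by exists (sval B0), B0.
      + by move=> _ [B _ <-]; case: (svalP B).
      + move=> _ _ [B FB <-] [D FD <-].
        case: (Ftot B D FB FD) => /asboolP BD.
          by exists (sval D); [exists D|move=> x Dx; split=> //; exact: BD].
        by exists (sval B); [exists B|move=> x Dx; split=> //; exact: BD].
      by exists p => B FB; apply: hp; exists B.
    - move=> x y Ix Iy B FB; case: (svalP B) => _ _ + _; apply; [exact: Ix|exact: Iy].
    - by move=> x Ix; case: (svalP B0) => _ _ _; apply; exact: Ix.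
  by exists (exist P I PI) => B FB; apply/asboolP => x; apply.
case: (PB) => cB [x Bx] BM BA.
have minB (D : set E) : closed D -> D !=set0 ->
    (forall x y, D x -> D y -> D (mul x y)) -> D `<=` B -> D = B.
  move=> cD D0 DM DB; have PD : P D by split=> // y /DB/BA.
  have BD : le (exist P B PB) (exist P D PD) by exact/asboolP.
  exact: (congr1 sval (Bmin _ BD)).
have Bxx : (mul^~ x) @` B = B.
  apply: minB.
  - apply: compact_closed; first exact: ds_hausdorff.
    apply: continuous_compact; last exact: subclosed_compact cB (@ds_compact E) _.
    by apply: continuous_subspaceT => y; exact: (ellis_continuous HE).
  - by exists (mul x x), x.
  - move=> _ _ [y By <-] [z Bz <-]; exists (mul (mul y x) z); last by rewrite !mulA.
    exact: (BM _ _ (BM _ _ By Bx) Bz).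
  - by move=> _ [y By <-]; exact: BM.
have fix_eq : B `&` [set y | mul y x = x] = B.
  apply: minB.
  - apply: closedI => //; apply: closed_agree.
    + exact: ds_hausdorff.
    + exact: (ellis_continuous HE).
    + by move=> y; exact: cst_continuous.
  - by move: Bx; rewrite -{1}Bxx => -[y By yx]; exists y.
  - by move=> y z [By yx] [Bz zx]; split; [exact: BM|rewrite /= -mulA zx].
  - by move=> y [].
by exists x; [exact: BA|move: Bx; rewrite -{1}fix_eq => -[]].
Qed.

Hypothesis Hq : forall f : E -> C, continuous f -> approximable (Gt) f.

Lemma continuous_separates (x y : E) : x <> y ->
  exists f : E -> C, [/\ continuous f, f x = 0 & f y = 1].
Proof.
move=> xy; have acc := hausdorff_accessible (@ds_hausdorff E).
have [||||f [cf f0 f1 _]] := @urysohn_ext_itv E R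
    (compact_normal (@ds_hausdorff E) (@ds_compact E)) [set x] [set y] 0 1.
- exact: accessible_closed_set1.
- exact: accessible_closed_set1.
- by apply/seteqP; split=> // z [/= -> /xy].
- exact: ltr01.
exists (fun z => (f z)%:C%C); split.
- move=> z; have Fz : Filter (nbhs z) by exact: nbhs_filter.
  apply/cvgrPdist_lt => -[a b]; rewrite ltcE /= => /andP[/eqP -> a0].
  have /cvgrPdist_lt/(_ a a0) := cf z; apply: filterS => w fzw.
  rewrite -rmorphB normc_def /= expr0n addr0 sqrtr_sqr -[(a +i* 0)%C]/(a%:C%C).
  by rewrite ltcR.
- by have -> : f x = 0 by apply: f0; exists x.
- by have -> : f y = 1 by apply: f1; exists y.
Qed.

Lemma Gall_separates x y : (forall g, Gt g -> g x = g y) -> x = y.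
Proof.
move=> gxy; apply: contrapT => /continuous_separates[f [cf fx fy]].
have e2 : 0 < 2^-1 :> C by rewrite invr_gt0.
have [h [s [sG hE]] fh] := Hq cf e2.
have hxy : h x = h y.
  by rewrite hE; apply: eq_big_seq => p /sG/gxy ->.
have : `|f y - f x| < 1.
  have -> : f y - f x = (f y - h y) - (f x - h x) by rewrite hxy opprB addrA subrK.
  apply: le_lt_trans (ler_normB _ _) _; rewrite [1]splitr mul1r.
  by apply: ltrD; exact: fh.
by rewrite fx fy subr0 normr1 ltxx.
Qed.

(** By induction on the degree u fixes [del u g], whereas idempotence makes the translate of
    [del u g] by u trivial. So u fixes all quasi-eigenfunctions, and these separate points. *)
Lemma idempotent_eq1 u : mul u u = u -> u = e.
Proof.
move=> uu; suff transu g : Gt g -> trans u g = g.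
  have xu x : mul x u = x.
    by apply: Gall_separates => g /transu {2}<-.
  by rewrite -{1}(mul1x u) xu.
move=> [m]; elim: m g => [|m IH] g gm; first exact/del_eq0/G_del0.
apply/del_eq0; have := IH _ (G_del u gm).
rewrite /tdiff transB -trans_mul uu subrr => <-.
by [].
Qed.

(** Each left ideal E c is a closed subsemigroup, so it contains an idempotent, which is e. Left
    inverses for all elements are two-sided. *)
Lemma ellis_inverse a : exists b, mul b a = e /\ mul a b = e.
Proof.
have left_inv c : exists b, mul b c = e.
  have [|||u [b _ <-] /idempotent_eq1 ?] := @ellis_numakura (range (mul^~ c)).
  - apply: compact_closed; first exact: ds_hausdorff.
    apply: continuous_compact; last exact: ds_compact.
    by apply: continuous_subspaceT => y; exact: (ellis_continuous HE).
  - by exists (mul e c), e.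
  - by move=> _ _ [x _ <-] [y _ <-]; exists (mul (mul x c) y); rewrite ?mulA.
  by exists b.
have [b ba] := left_inv a; have [c cb] := left_inv b; exists b; split=> //.
suff <- : c = a by [].
by rewrite -(mulx1 c) -ba mulA cb mul1x.
Qed.

Lemma trans_inj a : injective (trans a).
Proof.
move=> g h /(congr1 (trans _)) gh; have [b [ba _]] := ellis_inverse a.
by have := gh b; rewrite -!trans_mul ba !trans1.
Qed.

(** Left translations need not be continuous, so the claim is proved by density in z: the generator
    is central and [Sm m] is stable under translations. *)
Lemma S_agree m x y : (forall g, Sm m g -> g x = g y) ->
  forall z g, Sm m g -> g (mul z x) = g (mul z y).
Proof.
move=> gxy; have [b [bs sb]] := ellis_inverse se.
have shift z a : mul (mul z se) a = mul (mul z a) se.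
  by rewrite -mulA (mul_map_l HE) -(mul_map_r HE) mulA.
apply: (phase_ind HE) => [||z IH g gm|z IH g gm].
- apply: closed_forall => g; apply: closed_imply; apply: closed_agree.
  + exact: (C_hausdorff (R:=R)).
  + exact: (trans_circle HE x g).1.
  + exact: (trans_circle HE y g).1.
- by move=> g gm; rewrite !mul1x; exact: gxy.
- by rewrite !shift; exact: (IH (trans se g) (S_trans se gm)).
- have := IH (trans b g) (S_trans b gm).
  by rewrite !transE !shift -!mulA bs !mulx1.
Qed.

(** By [S_agree] for the points a and e, a test at e suffices; this is what makes the stabilizer
    closed. *)
Lemma FixP m a : (forall g, Sm m g -> g a = g e) <-> Fx m a.
Proof.
split=> [gae g gm|am g gm]; last by rewrite -(mul1x a) -(transE HE) am.
by apply/phase_eqP => x; rewrite transE (S_agree gae x gm) mulx1.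
Qed.

Lemma Fix_closed m : closed (Fx m).
Proof.
have -> : Fx m = [set a | forall g, Sm m g -> g a = g e].
  by apply/seteqP; split=> a /FixP.
by apply: closed_forall => g; apply: closed_imply; exact: phase_level_closed.
Qed.

Lemma Fix_inv m a b : mul b a = e -> Fx m a -> Fx m b.
Proof. by move=> ba am g gm; rewrite -{1}(am g gm) -trans_mul ba trans1. Qed.

(** If [Sm m] does not separate x and y, then y^(-1) x lies in the stabilizer, so v takes the same
    value at both and Stone-Weierstrass applies. *)
Lemma Fix_approximable m v : (forall a, Fx m a -> trans a v = v) ->
  approximable (Sm m) v.
Proof.
move=> vfix; apply: complex_stone_weierstrass.
- exact: S_0.
- by move=> g h; exact: S_sub.
- exact: phase_continuous.
move=> x y gxy; have [b [bx xb]] := ellis_inverse y.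
rewrite -[in X in X = _](mul1x x) -xb -mulA -(transE HE) vfix //.
by apply/FixP => g gm; rewrite (S_agree gxy b gm) bx.
Qed.

End GroupStructure.

(** * Degree one modulo torsion and eigenfunctions *)

Lemma prim_root_sum (F : fieldType) (n : nat) (w : F) (j : nat) :
  n.-primitive_root w -> (0 < j < n)%N -> \sum_(i < n) w ^- (i * j) = 0.
Proof.
move=> pw /andP[j0 jn]; have n0 : (0 < n)%N by exact: leq_trans jn.
pose v := w ^- j.
have v1 : v != 1.
  apply: contraTneq jn => v1; rewrite -leqNgt dvdn_leq // (prim_order_dvd pw).
  by rewrite -invr_eq1 -/v v1.
have : (v - 1) * \sum_(i < n) v ^+ i = 0.
  by rewrite -subrX1 /v -exprVn -exprM mulnC exprM exprVn (prim_expr_order pw) invr1 expr1n subrr.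
move/eqP; rewrite mulf_eq0 subr_eq0 (negPf v1) /= => /eqP v0; rewrite -[RHS]v0.
by apply: eq_bigr => i _; rewrite /v exprVn -exprM mulnC.
Qed.

Lemma closed_field_prim_root (F : numClosedFieldType) (n : nat) :
  (0 < n)%N -> exists w : F, n.-primitive_root w.
Proof.
move=> n0; pose p : {poly F} := 'X^n - 1.
have [r Dp] := closed_field_poly_normal p.
move: Dp; rewrite (monicP _) ?monicXnsubC // scale1r => Dp.
have rn1 : all n.-unity_root r by apply/allP=> z; rewrite -root_prod_XsubC -Dp.
have sz_r : (n < (size r).+1)%N by rewrite -(size_prod_XsubC r id) -Dp size_XnsubC.
have ur : uniq r by rewrite -separable_prod_XsubC -Dp separable_Xn_sub_1 // pnatr_eq0 -lt0n.
by have /hasP[z _ pz] := cyclic.has_prim_root n0 rn1 ur sz_r; exists z.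
Qed.

Section Characters.
Context (R : realType) (E : dynSys) (mul : E -> E -> E) (e : E).
Hypothesis HE : is_ellis mul e.
Local Notation C := (Cx R).
Local Notation se := (ds_map e).
Local Notation Gt := (@quasi_phase R E mul e HE).
Local Notation Gm := (@degree_le R E mul e HE).
Local Notation Sm := (@degree_le_tors R E mul e HE).
Local Notation trans := (@translate R E mul e HE).
Local Notation del := (@tdiff R E mul e HE).
Local Notation D := (del se).

Let mulA := ellis_mulA HE.
Let mul1x := ellis_mul1x HE.
Let mulx1 := ellis_mulx1 HE.

Hypothesis Hq : forall f : E -> C, continuous f -> approximable Gt f.

Definition ellis_pow (a : E) (n : nat) : E := iter n (mul a) e.
Local Notation pw := ellis_pow.

Lemma pwD a m n : pw a (m + n) = mul (pw a m) (pw a n).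
Proof. by elim: m => [|m IH]; rewrite ?mul1x // addSn /= IH mulA. Qed.

Lemma pwM a m n : pw a (m * n) = pw (pw a m) n.
Proof. by elim: n => [|n IH]; rewrite ?muln0 // mulnS pwD IH. Qed.

Lemma trans_pw a n g : trans (pw a n) g = iter n (trans a) g.
Proof. by elim: n => [|n IH] /=; rewrite ?trans1 // trans_mul IH. Qed.

Lemma del_mul a b g : D (del b g) = 0 -> del (mul a b) g = del a g + del b g.
Proof.
move=> Db; rewrite {1}/tdiff trans_mul (trans_del HE b g) transD.
by rewrite (D_eq0_trans a Db) -addrA addrC.
Qed.

Lemma del_pw a n g : D (del a g) = 0 -> del (pw a n) g = del a g *+ n.
Proof.
move=> Da; elim: n => [|n IH]; first by rewrite mulr0n; apply/del_eq0; exact: trans1.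
rewrite mulrS /= del_mul IH // delMn Da; exact: mul0rn.
Qed.

Lemma del_e a g : (del a g) e = g a / g e.
Proof. by rewrite phaseB transE mul1x. Qed.

Lemma phase_pw a n g : D (del a g) = 0 -> g (pw a n) = g e * (del a g) e ^+ n.
Proof.
move=> Da; rewrite -phaseMn -(del_pw n Da) del_e mulrC divfK //; exact: phase_neq0.
Qed.

Lemma invariant_const (f : E -> C) : continuous f ->
  (forall x, f (mul x se) = f x) -> forall x, f x = f e.
Proof.
move=> cf fs; apply: (phase_ind HE) => // [|x|x]; rewrite ?fs //.
apply: closed_agree; [exact: C_hausdorff|exact: cf|].
by move=> x; exact: cst_continuous.
Qed.

(** The modulus of h is invariant, hence constant; so h is zero or a scalar multiple of a phase
    whose difference is the constant z. *)
Lemma eigenfunction_tspan (h : E -> C) (z : C) : continuous h -> `|z| = 1 ->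
  (forall x, h (mul x se) = z * h x) -> tspan (Gm 1) h.
Proof.
move=> ch z1 hz.
have nh x : `|h x| = `|h e|.
  apply: (@invariant_const (fun x => `|h x|)) => [y|y].
    by apply: cvg_norm; exact: ch.
  by rewrite hz normrM z1 mul1r.
have [h0|h0] := eqVneq (h e) 0.
  have -> : h = fun=> 0.
    by apply/funext => x; apply/eqP; rewrite -normr_eq0 nh h0 normr0.
  exact: tspan0.
pose r := `|h e|; have r0 : r != 0 by rewrite normr_eq0.
have cp : @circle_fun R E (fun x => h x / r).
  split=> x; first by apply: cvgM; [exact: ch|exact: cvg_cst].
  by rewrite normrM normfV normr_id nh divff.
have -> : h = fun x => r * Phase cp x by apply/funext => x /=; rewrite mulrC divfK.
apply: tspan_gen; apply/D_eq0 => x; have xz y : (D (Phase cp)) y = z.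
  rewrite phaseB transE /= hz -(mulrA z) mulfK // mulf_neq0 ?invr_eq0 //.
  by rewrite -normr_eq0 nh normr_eq0.
exact: etrans (xz x) (esym (xz e)).
Qed.

(** The difference [D g] has a period q, so g is an eigenfunction of the q-th power of the
    generator, with eigenvalue c. A discrete Fourier transform over the q-th roots of c splits g
    into eigenfunctions of the generator. *)
Lemma S1_tspan g : Sm 1 g -> tspan (Gm 1) g.
Proof.
move=> g1; have [q q0 Dgq] := S0_periodic se (S_D g1).
pose t := pw se q; pose k := del t g.
have Dk : D k = 0 by rewrite D_del; apply/del_eq0; rewrite trans_pw.
pose c := k e; have c1 : `|c| = 1 by exact: norm_phase.
have gt x : g (mul x t) = c * g x.
  have kx : k x = c by have /D_eq0 := Dk; apply.
  by rewrite -kx phaseB transE divfK // phase_neq0.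
pose mu := q.-root c.
have muq : mu ^+ q = c by exact: rootCK.
have mu1 : `|mu| = 1.
  by apply/eqP; rewrite -(@pexpr_eq1 _ _ q) // -normrX muq c1.
have [w pq] := closed_field_prim_root C q0.
have w1 : `|w| = 1.
  by apply/eqP; rewrite -(@pexpr_eq1 _ _ q) // -normrX (prim_expr_order pq) normr1.
have mu0 : mu != 0 by rewrite -normr_eq0 mu1 oner_eq0.
have w0 : w != 0 by rewrite -normr_eq0 w1 oner_eq0.
pose nu i := mu * w ^+ i.
have nu0 i : nu i != 0 by rewrite mulf_neq0 // expf_neq0.
have nu1 i : `|nu i| = 1 by rewrite normrM mu1 normrX w1 expr1n mulr1.
have nuq i : nu i ^+ q = c.
  by rewrite exprMn muq -exprM mulnC exprM (prim_expr_order pq) expr1n mulr1.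
pose a j x := g (mul x (pw se j)).
have a0 x : a 0%N x = g x by rewrite /a /= mulx1.
have aq x : a q x = c * g x by exact: gt.
have aS j x : a j (mul x se) = a j.+1 x by rewrite /a -mulA.
(* Up to the factor q, the component of g for the eigenvalue [nu i]. As its q-th power is c, the
   generator permutes the terms cyclically, up to the factor [nu i]. *)
pose ev i x := \sum_(0 <= j < q) nu i ^- j * a j x.
have ev_eigen i x : ev i (mul x se) = nu i * ev i x.
  rewrite /ev mulr_sumr; transitivity (\sum_(1 <= j < q.+1) nu i * (nu i ^- j * a j x)).
    rewrite big_add1 /=; apply: eq_bigr => j _; rewrite aS mulrA; congr (_ * _).
    by rewrite exprS invfM mulrA divff // mul1r.
  apply: (@addrI _ (nu i * (nu i ^- 0 * a 0%N x))).
  rewrite -big_ltn // big_nat_recr //= [RHS]addrC; congr (_ + _).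
  by rewrite nuq aq a0 expr0 invr1 mul1r [_^-1 * _]mulKf // -normr_eq0 c1 oner_eq0.
have ev_cont i : continuous (ev i).
  apply: (@tspan_continuous R E setT); rewrite /ev.
  apply: tspan_sum => j _; exact: (@tspan_gen R E setT _ (trans (pw se j) g)).
have -> : (g : E -> C) = fun x => q%:R^-1 * \sum_(i <- index_enum 'I_q) ev i x.
  apply/funext => x; apply: (@mulfI _ q%:R); first by rewrite pnatr_eq0 -lt0n.
  rewrite mulrA divff ?pnatr_eq0 -?lt0n // mul1r /ev exchange_big /=.
  (* Only j = 0 survives summation over i, by orthogonality of the roots of unity. *)
  rewrite big_ltn // [X in _ + X]big_nat_cond [X in _ + X]big1 => [|j /andP[/andP[j0 jq] _]].
    under eq_bigr do rewrite expr0 invr1 mul1r a0.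
    by rewrite sumr_const card_ord addr0 mulr_natl.
  rewrite -mulr_suml.
  under eq_bigr do rewrite exprMn -exprM invfM.
  by rewrite -mulr_sumr prim_root_sum ?j0 // mulr0 mul0r.
apply/tspan_scale/tspan_sum => i _.
exact: eigenfunction_tspan (ev_cont i) (nu1 i) (ev_eigen i).
Qed.

End Characters.

(** * Density of the action on phases of a given degree *)

Lemma sequence_cluster (T : topologicalType) (u : nat -> T) :
  compact [set: T] -> exists y : T, forall (V : set T) n, nbhs y V ->
    exists2 m, (n <= m)%N & V (u m).
Proof.
move=> cT; have [y [_ cly]] := cT (u @ \oo) (fmap_proper_filter _ _) filterT.
exists y => V n nV.
have un : (u @ \oo) (u @` [set m | (n <= m)%N]).
  by exists n => // m nm; exists m.
by have [_ [[m nm <-] Vm]] := cly _ _ un nV; exists m.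
Qed.

Lemma real_closed_dense (R : realType) (H : set (Cx R)) z : closed H ->
  (forall d : Cx R, 0 < d -> exists2 w, H w & `|z - w| < d) -> H z.
Proof.
move=> cH dz; apply: cH => B /nbhs_ballP[d /= d0 zB].
have [w Hw zw] := dz d d0; exists w; split=> //.
by apply: zB; rewrite -ball_normE.
Qed.

Section Density.
Context (R : realType) (E : dynSys) (mul : E -> E -> E) (e : E).
Hypothesis HE : is_ellis mul e.
Local Notation C := (Cx R).
Local Notation U := (phase R E).
Local Notation se := (ds_map e).
Local Notation Gt := (@quasi_phase R E mul e HE).
Local Notation Gm := (@degree_le R E mul e HE).
Local Notation Sm := (@degree_le_tors R E mul e HE).
Local Notation Fx := (@degree_stab R E mul e HE).
Local Notation trans := (@translate R E mul e HE).
Local Notation del := (@tdiff R E mul e HE).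
Local Notation D := (del se).
Local Notation pw := (@ellis_pow E mul e).

Let mul1x := ellis_mul1x HE.
Let mulx1 := ellis_mulx1 HE.

Hypothesis Hq : forall f : E -> C, continuous f -> approximable Gt f.

Lemma near_phases (s : seq U) (y : E) (d : C) : 0 < d ->
  nbhs y [set z | forall g, g \in s -> `|g y - g z| < d].
Proof.
move=> d0; elim: s => [|g s IH].
  by apply: (@filterS _ (nbhs y) _ setT); [move=> z _ g|exact: filterT].
have Fy : Filter (nbhs y) by exact: nbhs_filter.
have /cvgrPdist_lt/(_ _ d0) := @phase_continuous _ _ g y.
move: IH; apply: filterS2 => z hs hg h; rewrite inE => /orP[/eqP ->|/hs] //.
Qed.

Lemma recurrence (s : seq U) (b : E) (d : C) : 0 < d ->
  exists k l, (k < l)%N /\ forall g, g \in s -> `|g (pw b k) - g (pw b l)| < d.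
Proof.
move=> d0; have [y hy] := sequence_cluster (pw b) (@ds_compact E).
have d2 : 0 < d / 2 by rewrite divr_gt0.
have [k _ hk] := hy _ 0%N (near_phases s y d2).
have [l kl hl] := hy _ k.+1 (near_phases s y d2).
exists k, l; split=> // g gs.
have -> : g (pw b k) - g (pw b l) = (g y - g (pw b l)) - (g y - g (pw b k)) by ring.
apply: le_lt_trans (ler_normB _ _) _; rewrite [d]splitr.
by apply: ltrD; [exact: hl|exact: hk].
Qed.

Lemma const_mulrn (k : U) n : D k = 0 -> k e ^+ n = 1 -> k *+ n = 0.
Proof.
move=> Dk kn; apply: (const_eq0 (HE:=HE)) => [|]; last by rewrite phaseMn.
by rewrite delMn Dk mul0rn.
Qed.

Lemma common_period (s : seq (C * U)) : (forall p, p \in s -> Sm 0 p.2) ->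
  exists2 q, (0 < q)%N & forall p, p \in s -> trans (pw se q) p.2 = p.2.
Proof.
elim: s => [|p s IH] sS; first by exists 1%N.
have [q q0 hq] : exists2 q, (0 < q)%N & forall p, p \in s -> trans (pw se q) p.2 = p.2.
  by apply: IH => p' p's; apply: sS; rewrite in_cons p's orbT.
have [r r0 hr] := S0_periodic se (sS p (mem_head _ _)).
have iter_id m x (g : U) : trans x g = g -> trans (ellis_pow mul e x m) g = g.
  by move=> xg; rewrite trans_pw; elim: m => [|m IHm] //=; rewrite IHm.
exists (q * r)%N => [|p']; first by rewrite muln_gt0 q0.
rewrite inE => /orP[/eqP ->|p's].
  by rewrite mulnC (pwM HE); apply: iter_id; rewrite trans_pw.
by rewrite (pwM HE); apply: iter_id; exact: hq.
Qed.

Lemma dist_shift (u h : E -> C) d x y : (forall z, `|u z - h z| < d) -> h x = h y ->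
  `|u x - u y| < d + d.
Proof.
move=> uh hxy.
have -> : u x - u y = (u x - h x) - (u y - h y) by rewrite hxy; ring.
by apply: le_lt_trans (ler_normB _ _) _; exact: ltrD.
Qed.

Lemma dist_pw a n u : D (del a u) = 0 ->
  `|u (pw a n) - u e| = `|(del a u) e ^+ n - 1|.
Proof.
move=> Da; rewrite (phase_pw n Da) -[X in `|_ - X| = _]mulr1 -mulrBr.
by rewrite normrM norm_phase mul1r.
Qed.

(** A combination h of phases in [Sm 0] is periodic under a power t of the generator, while t
    multiplies u by a constant w. If h is within 1/4 of u, the powers of w stay within 1/2 of 1, so
    w = 1 and a multiple of u is constant. *)
Lemma nonapprox0 u : Gm 1 u -> ~ Sm 0 u -> ~ approximable (Sm 0) u.
Proof.
move=> u1 nu apu.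
have d0 : 0 < 4^-1 :> C by rewrite invr_gt0.
have [h [s [sS hE]] uh] := apu _ d0.
have [q q0 sq] := common_period sS; pose t := pw se q.
have ht x : h (mul x t) = h x.
  by rewrite hE; apply: eq_big_seq => p ps; rewrite -(transE HE) sq.
have hpw n : h (pw t n) = h e.
  by elim: n => [|n IH] //; rewrite -addn1 (pwD HE) -[pw t 1]/(mul t e) mulx1 ht.
pose w := (del t u) e.
have Dt : D (del t u) = 0 := G_del t u1.
have w1 : w = 1.
  apply/eqP/negPn/negP => /(power_far_from_one (norm_phase _ _))[n].
  apply/negP; rewrite -real_ltNge ?normr_real ?rpredV ?realn //.
  rewrite -(dist_pw n Dt); apply: lt_le_trans (dist_shift uh (hpw n)) _.
  by rewrite le_eqVlt; apply/orP; left; apply/eqP; field.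
apply: nu; split; first by exists 1%N.
exists q => //; have DDu : D (D u) = 0 := u1.
rewrite GE /tdiff_iter /= delMn -(del_pw q DDu).
exact: const_eq0 Dt w1.
Qed.

(* As b shifts D u by a constant of infinite order, the translates of u by
   powers of b stay far from u, while those of a combination of phases of
   lower degree return close to it. *)
Lemma nonapproxS j u w b z : (forall n, (0 < n)%N -> z ^+ n != 1) ->
  w = D u -> D (del b w) = 0 -> (forall g, Sm j.+1 g -> D (del b g) = 0) ->
  (del b w) e = z -> ~ approximable (Sm j.+1) u.
Proof.
move=> zn wE Dbw bS bwz apu.
(* The phase k' below stays within 3d of 1, so its values differ by less than 6d, short of the
   distance 1/2 = 8d given by [power_far_from_one]. *)
pose d : C := 16^-1; have d0 : 0 < d by rewrite invr_gt0.
have [h [s [sS hE]] uh] := apu _ d0.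
pose M := \sum_(p <- s) `|p.1|.
have M0 : 0 <= M by exact: sumr_ge0.
have d0' : 0 < d / (1 + M) by rewrite divr_gt0 // ltr_wpDr.
have [k [l [kl hkl]]] := recurrence (map snd s) b d0'.
pose n := (l - k)%N; have n0 : (0 < n)%N by rewrite subn_gt0.
have hn x : `|h (mul x (pw b n)) - h x| <= d.
  rewrite hE -sumrB; apply: le_trans (ler_norm_sum _ _ _) _.
  apply: le_trans (_ : \sum_(p <- s) `|p.1| * (d / (1 + M)) <= _).
    rewrite [leLHS]big_seq [leRHS]big_seq; apply: ler_sum => p ps.
    have Dp := bS _ (sS p ps).
    rewrite -mulrBr normrM ler_wpM2l // ltW //.
    have pn : p.2 (mul x (pw b n)) = (del b p.2) e ^+ n * p.2 x.
      rewrite -(transE HE) trans_del phaseD (del_pw n Dp) phaseMn.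
      by have /D_eq0 -> := Dp.
    have := hkl p.2 (map_f snd ps).
    rewrite -(subnKC (ltnW kl)) -/n !(phase_pw _ Dp) exprD mulrA -[X in X - _]mulr1.
    rewrite -mulrBr !normrM norm_phase normrX norm_phase expr1n mulr1 mul1r => hz.
    by rewrite pn -[X in _ - X]mul1r -mulrBl normrM norm_phase mulr1 distrC.
  rewrite -mulr_suml -/M mulrCA ger_pMr // ler_pdivrMr ?ltr_wpDr // mul1r.
  by rewrite lerDr.
pose k' := del (pw b n) u.
have hk' x : `|k' x - 1| < d *+ 3.
  have -> : `|k' x - 1| = `|u (mul x (pw b n)) - u x|.
    rewrite /k' -[LHS]mulr1 -[X in _ * X](norm_phase u x) -normrM mulrBl mul1r.
    by rewrite phaseB transE divfK // phase_neq0.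
  have -> : u (mul x (pw b n)) - u x = (u (mul x (pw b n)) - h (mul x (pw b n)))
     + (h (mul x (pw b n)) - h x) - (u x - h x) by ring.
  apply: le_lt_trans (ler_normB _ _) _.
  rewrite mulrSr; apply: ltrD => //; apply: le_lt_trans (ler_normD _ _) _.
  by rewrite mulr2n; apply: ltr_leD.
(* So the generator multiplies k' by the constant z^n, which is not 1, and the values of k' at
   powers of [se] spread out. *)
have Dk' : D k' = (del b w) *+ n by rewrite D_del -wE del_pw.
have DDk' : D (D k') = 0 by rewrite Dk' delMn Dbw mul0rn.
pose v := (D k') e.
have v1 : v != 1 by rewrite /v Dk' phaseMn bwz zn.
have [m] := power_far_from_one (norm_phase _ _) v1.
apply/negP; rewrite -real_ltNge ?normr_real ?rpredV ?realn //.
rewrite -(dist_pw m DDk').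
have -> : k' (pw se m) - k' e = (k' (pw se m) - 1) - (k' e - 1) by ring.
apply: le_lt_trans (ler_normB _ _) _.
apply: lt_le_trans (ltrD (hk' _) (hk' _)) _.
have -> : 2^-1 = d *+ 8 :> C by rewrite /d -mulr_natr; field.
by rewrite -mulrnDr ler_wpMn2l // ltW.
Qed.

Lemma del_e_continuous (v : U) : continuous (fun b : E => v b / v e).
Proof.
by move=> b; apply: cvgM; [exact: phase_continuous|exact: cvg_cst].
Qed.

Lemma del_image_closed (A : set E) v : closed A ->
  closed [set w | exists2 b, A b & (del b v) e = w].
Proof.
move=> cA.
have -> : [set w | exists2 b, A b & (del b v) e = w] = (fun b => v b / v e) @` A.
  by apply/seteqP; split=> w [b Ab <-]; exists b; rewrite ?del_e.
apply: compact_closed; first exact: (C_hausdorff (R:=R)).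
apply: continuous_compact; last exact: subclosed_compact cA (@ds_compact E) _.
by apply: continuous_subspaceT; exact: del_e_continuous.
Qed.

(** The constants by which [Fx j] multiplies v form a closed subgroup of the circle. If it had
    finite exponent, a multiple of v would be fixed by [Fx j], hence approximable by [Sm j], against
    the first hypothesis; so it is dense. *)
Lemma Fix_del_full j v z :
  (forall u, Gm j.+1 u -> ~ Sm j u -> ~ approximable (Sm j) u) ->
  Sm j.+1 v -> ~ Sm j v -> `|z| = 1 -> exists2 b, Fx j b & (del b v) e = z.
Proof.
move=> nonapp vS nvS z1.
pose H := [set w | exists2 b, Fx j b & (del b v) e = w].
have Dv b : Fx j b -> D (del b v) = 0 by move=> bF; exact: Fix_del bF vS.
have cH : closed H by apply: del_image_closed; exact: (Fix_closed Hq).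
have [||||[d d0 Hd]|] := @dense_subgroup_circle R H.
- by move=> _ [b _ <-]; exact: norm_phase.
- exists e; first by move=> g _; exact: trans1.
  by rewrite del_e divff // phase_neq0.
- move=> _ _ [a aF <-] [b bF <-]; exists (mul a b); first exact: Fix_mul.
  by rewrite del_mul ?phaseD //; exact: Dv.
- move=> _ [a aF <-]; have [b [ba ab]] := ellis_inverse Hq a.
  exists b; first exact: Fix_inv ba aF.
  have : del (mul b a) v = 0 by rewrite ba; apply/del_eq0; exact: trans1.
  rewrite del_mul ?(Dv a) // => /eqP; rewrite addr_eq0 => /eqP ->.
  by rewrite phaseN.
- case: (vS) => Gv [c c0 vc].
  case: (nonapp (v *+ (c * d))).
  + by rewrite mulrnA; exact: G_muln.
  + by move=> h; apply: nvS; apply: S_torsion h => //; rewrite muln_gt0 c0.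
  apply: Fix_approximable => // b bF; apply/del_eq0.
  rewrite delMn; apply: const_mulrn; first exact: Dv.
  by rewrite mulnC exprM Hd ?expr1n //; exists b.
- by move=> dz; apply: (real_closed_dense cH) => r r0; exact: dz.
Qed.

(** The form of Weyl's theorem. For u of degree j + 2, the previous case applied to [D u] gives an
    element that acts on degree j + 1 by constants, with a constant of infinite order on [D u]; then
    [nonapproxS] applies to u. *)
Lemma Fix_del_surj j v z : Sm j.+1 v -> ~ Sm j v -> `|z| = 1 ->
  exists2 b, Fx j b & (del b v) e = z.
Proof.
elim: j v z => [|j IH] v z; apply: Fix_del_full; first exact: nonapprox0.
move=> u uG nuS.
have uS : Sm j.+2 u by exact: S_G.
have DuS : Sm j.+1 (D u) by exact: S_D.
have nDu : ~ Sm j (D u).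
  by move=> h; apply: nuS; apply/(S_Dn 1 j uS.1).
have [b bF bz] := IH _ _ DuS nDu (norm_nontorsion R).
apply: (nonapproxS (w := D u) (b := b)) bz => //.
- exact: nontorsion_expr.
- exact: Fix_del bF DuS.
- by move=> g; exact: Fix_del.
Qed.

End Density.

(** * Closed normal subgroups *)

Section NormalSubgroups.
Context (R : realType) (E : dynSys) (mul : E -> E -> E) (e : E).
Hypothesis HE : is_ellis mul e.
Local Notation C := (Cx R).
Local Notation U := (phase R E).
Local Notation se := (ds_map e).
Local Notation Gt := (@quasi_phase R E mul e HE).
Local Notation Gm := (@degree_le R E mul e HE).
Local Notation Sm := (@degree_le_tors R E mul e HE).
Local Notation Fx := (@degree_stab R E mul e HE).
Local Notation trans := (@translate R E mul e HE).
Local Notation del := (@tdiff R E mul e HE).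
Local Notation Dn := (@tdiff_iter R E mul e HE).
Local Notation D := (del se).
Local Notation pw := (@ellis_pow E mul e).

Let mul1x := ellis_mul1x HE.

Hypothesis Hq : forall f : E -> C, continuous f -> approximable Gt f.

(** After l + 1 differences x has degree j modulo torsion, which b fixes; so [del b x] has degree at
    most l and a fixes it. After j + 1 differences a multiple of x has degree l, so [del a x] lies
    in [Sm j] and b fixes it. *)
Lemma commute_below l j a b x : (forall y, Gm l y -> trans a y = y) ->
  Fx j b -> Sm (l.+1 + j) x -> del a (del b x) = 0 /\ del b (del a x) = 0.
Proof.
move=> al bj xS; split.
  apply/del_eq0/al; rewrite GE Dn_del; apply/del_eq0/bj.
  by apply/(S_Dn l.+1 j xS.1).
apply/del_eq0/bj; case: (xS) => Gx [d d0 xd]; split; first exact: Gall_del.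
exists d => //; rewrite -delMn GE Dn_del; apply/del_eq0/al.
by rewrite GE -Dn_add addnS.
Qed.

Lemma commute_top l j a b g : (forall y, Gm l y -> trans a y = y) ->
  Fx j b -> Sm (l.+1 + j).+1 g ->
  D (del a (del b g)) = 0 /\ D (del b (del a g)) = 0.
Proof.
move=> al bj gS; have := commute_below al bj (S_D gS).
by rewrite !D_del.
Qed.

Lemma trans_trans a b x :
  trans a (trans b x) = del a (del b x) + (del a x + (del b x + x)).
Proof.
rewrite (trans_del HE b x) transD (trans_del HE a x) (trans_del HE a (del b x)).
move: (del b x) (del a x) (del a (del b x)) => r q p.
by rewrite -!addrA; congr (_ + _); rewrite addrCA.
Qed.

Lemma trans_comm a b c x : mul a b = mul (mul b a) c ->
  trans a (trans b x) = trans b (trans a (trans c x)).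
Proof. by move=> abc; rewrite -!trans_mul abc. Qed.

Lemma trans_comm_eq a b x : del a (del b x) = del b (del a x) <->
  trans a (trans b x) = trans b (trans a x).
Proof.
rewrite !trans_trans; move: (del a (del b x)) (del b (del a x)) => p q.
by rewrite (addrCA (del b x)); split=> [-> //|/addIr].
Qed.

(** Both mixed differences vanish by [commute_below], so ab and ba act alike. *)
Lemma commutator_Fix l j a b c : (forall y, Gm l y -> trans a y = y) ->
  Fx j b -> mul a b = mul (mul b a) c -> Fx (l.+1 + j) c.
Proof.
move=> al bj abc x xS; apply: (trans_inj Hq (a := mul b a)).
rewrite !trans_mul -(trans_comm x abc); apply/trans_comm_eq.
by have [-> ->] := commute_below al bj xS.
Qed.

(** [N_comm] is normality, stated through the commutator c = (ba)^(-1) ab. *)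
Variable N : set E.
Hypotheses (N_closed : closed N) (N_e : N e)
  (N_mul : forall a b, N a -> N b -> N (mul a b))
  (N_comm : forall a b, N a -> exists2 c, N c & mul a b = mul (mul b a) c).

(** The commutator of a and b lies in N and fixes degree l + 1 + j, so it fixes g by assumption,
    although g may have higher degree. *)
Lemma commuting_of_unmoved l j a b g : (forall c, N c -> Fx (l.+1 + j) c -> trans c g = g) ->
  N a -> (forall y, Gm l y -> trans a y = y) -> Fx j b ->
  del a (del b g) = del b (del a g).
Proof.
move=> nokill Na al bj; have [c Nc abc] := N_comm b Na.
apply/trans_comm_eq; rewrite (trans_comm g abc) nokill //.
exact: commutator_Fix al bj abc.
Qed.

Lemma S_Dn_succ l j g : Sm (l.+1 + j).+1 g -> ~ Sm (l.+1 + j) g ->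
  Sm j.+1 (Dn l.+1 g) /\ ~ Sm j (Dn l.+1 g).
Proof.
move=> gS ngS; split; first by apply/(S_Dn l.+1 j.+1 gS.1); rewrite addnS.
by move=> h; apply: ngS; apply/(S_Dn l.+1 j gS.1).
Qed.

(* Leads of the phases del b g, for b in Fx j, exhaust the circle; those
   with lead a root of unity lie in Sm l, hence are fixed by a. As the
   b for which del b g is fixed by a form a closed set, a fixes all of them. *)
Lemma Fix_step l j g a : (forall c, N c -> Fx (l.+1 + j) c -> trans c g = g) ->
  Sm (l.+1 + j).+1 g -> ~ Sm (l.+1 + j) g -> N a -> Fx l a -> Fx l.+1 a.
Proof.
move=> nokill gS ngS Na al h hS.
have alG y : Gm l y -> trans a y = y by move=> /S_G /al.
have [vS nvS] := S_Dn_succ gS ngS; set v := Dn l.+1 g in vS nvS.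
pose w := del a g.
have comm b : Fx j b -> del a (del b g) = del b w.
  exact: commuting_of_unmoved nokill Na alG.
have Dw b : Fx j b -> D (del b w) = 0 by move=> bj; have [] := commute_top alG bj gS.
have lead b : Dn l.+1 (del b g) = del b v by rewrite Dn_del.
have Dv b : Fx j b -> D (del b v) = 0 by move=> bj; exact: Fix_del bj vS.
have bG b : Fx j b -> Gm l.+1 (del b g).
  by move=> bj; rewrite GE DnS lead Dv.
pose A := Fx j `&` [set b | w b = w e].
have cA : closed A.
  apply: closedI; first exact: (Fix_closed Hq).
  exact: phase_level_closed.
(* z is the lead of d h. If [del b g] has as lead a d-th root t of z, it agrees with h up to degree
   l modulo torsion, where a acts trivially. *)
have [d d0 hd] := hS.2; pose z := (Dn l.+1 (h *+ d)) e.
pose t := d.-root z.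
have td : t ^+ d = z by exact: rootCK.
have t1 : `|t| = 1.
  by apply/eqP; rewrite -(@pexpr_eq1 _ _ d) // -normrX td norm_phase.
have [b [bj wb] bt] : [set u | exists2 b, A b & (del b v) e = u] t.
  apply: real_closed_dense; first exact: del_image_closed.
  move=> r r0; have [u [n [n0 un tu]]] := roots_of_unity_dense t1 r0.
  exists u => //; have u1 : `|u| = 1.
    by apply/eqP; rewrite -(@pexpr_eq1 _ _ n) // -normrX un normr1.
  have [b bj bu] := Fix_del_surj Hq vS nvS u1.
  exists b => //; split=> //=.
  have bS : Sm l (del b g).
    split; first exact/Gall_del/gS.1.
    exists n => //; rewrite GE DnMn lead; apply: (@const_mulrn R E mul e HE); first exact: Dv.
    by rewrite bu.
  have : del b w = 0 by rewrite -comm //; apply/del_eq0/al.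
  move=> /(congr1 (fun k : U => k e)); rewrite del_e => /(canRL (divfK (phase_neq0 w e))).
  by rewrite phase0 mul1r.
have hb : Sm l (h - del b g).
  split; first by apply: Gall_sub; [exact: hS.1|exact/Gall_del/gS.1].
  exists d => //; rewrite GE DnMn DnB lead mulrnBl -DnMn; apply/eqP; rewrite subr_eq0.
  apply/eqP; apply: (const_eq (HE := HE)).
  - exact: hd.
  - by rewrite delMn Dv // mul0rn.
  - by rewrite phaseMn bt td.
have aw : del b w = 0.
  apply: (const_eq0 (Dw _ bj)); rewrite del_e wb divff //; exact: phase_neq0.
have := al _ hb; rewrite transB => /eqP.
have -> : trans a (del b g) = del b g by apply/del_eq0; rewrite comm.
by move=> /eqP/addIr.
Qed.

(* If a moved a character, then a suitable limit y of powers of a would act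
   trivially on Sm 0 but not on the characters del b g, against Fix_step. *)
Lemma Fix_one j g a : (forall c, N c -> Fx j.+1 c -> trans c g = g) ->
  Sm j.+2 g -> ~ Sm j.+1 g -> N a -> Fx 1 a.
Proof.
move=> nokill gS ngS Na.
have G0 y : Gm 0 y -> trans a y = y by move=> /(G_del0 a)/del_eq0.
have [vS nvS] := @S_Dn_succ 0 j g gS ngS; set v := Dn 1 g in vS nvS.
pose w := del a g.
have wS : Sm j.+1 w by exact: S_del.
have comm b : Fx j b -> del a (del b g) = del b w.
  exact: (@commuting_of_unmoved 0 j).
have lead b : D (del b g) = del b v by rewrite D_del.
have Dv b : Fx j b -> D (del b v) = 0 by move=> bj; exact: Fix_del bj vS.
have bG b : Fx j b -> Gm 1 (del b g).
  by move=> bj; rewrite GE DnS -[Dn 1 _]/(D (del b g)) lead Dv.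
suff fixG h : Gm 1 h -> trans a h = h.
  move=> h hS; have [s [sG hE]] := S1_tspan hS.
  apply/phase_eqP => x; rewrite transE hE; apply: eq_big_seq => p /sG/fixG pa.
  by rewrite -[in RHS]pa.
(* If w lies in [Sm j], every b in [Fx j] fixes w, so a fixes every [del b g]; their leads exhaust
   the circle, and a fixes h. The other case is contradictory. *)
move=> hG; have [wS0|nwS] := pselect (Sm j w).
  have h1 : `|(D h) e| = 1 by exact: norm_phase.
  have [b bj bh] := Fix_del_surj Hq vS nvS h1.
  have hb : Gm 0 (h - del b g).
    rewrite GE -[Dn 1 _]/(D (h - del b g)) delB lead; apply/eqP; rewrite subr_eq0; apply/eqP.
    by apply: (const_eq (HE := HE)) => //; exact: Dv.
  have := G0 _ hb; rewrite transB.
  have -> : trans a (del b g) = del b g by apply/del_eq0; rewrite comm //; exact/del_eq0/bj.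
  by move=> /addIr.
have [b bj bz] := Fix_del_surj Hq wS nwS (norm_nontorsion R).
pose r := del b g; have rG : Gm 1 r by exact: bG.
have ar : (del a r) e = nontorsion R by rewrite comm.
have Dar : D (del a r) = 0 by rewrite comm //; exact: Fix_del bj wS.
(* The factor k! makes the powers of a eventually trivial on each periodic phase, while n keeps
   their eigenvalue on r at distance at least 1/2 from 1. *)
have powers k : exists n, 2^-1 <= `|nontorsion R ^+ (k`! * n) - 1|.
  have [|n] := @power_far_from_one R (nontorsion R ^+ k`!) _ (nontorsion_expr _ (fact_gt0 k)).
    by rewrite normrX norm_nontorsion expr1n.
  by rewrite -exprM; exists n.
have [n hn] := choice powers.
have [y hy] := sequence_cluster (fun k => pw a (k`! * n k)) (@ds_compact E).
have Npw m : N (pw a m) by elim: m => [|m IH] //=; exact: N_mul.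
have closed_lim (A : set E) q : closed A -> (forall k, (q <= k)%N -> A (pw a (k`! * n k))) -> A y.
  move=> cA Ak; apply: cA => B nB; have [m qm Bm] := hy B q nB.
  by exists (pw a (m`! * n m)); split=> //; exact: Ak.
have Ny : N y by apply: (closed_lim N 0%N) => // k _; exact: Npw.
have y0 : Fx 0 y.
  apply/(FixP Hq) => x xS; have [q q0 xq] := S0_periodic a xS.
  apply: (closed_lim [set z | x z = x e] q) => [|k qk] /=.
    exact: (@phase_level_closed R E x (x e)).
  have /dvdnP[m ->] : (q %| k`! * n k)%N by rewrite dvdn_mulr // dvdn_fact // q0.
  rewrite -(mul1x (pw _ _)) -(transE HE) mulnC pwM // trans_pw.
  suff -> : iter m (trans (pw a q)) x = x by [].
  by elim: m => [|m IH] //=; rewrite IH trans_pw.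
have y1 := @Fix_step 0 j g y nokill gS ngS Ny y0.
have ry : r y = r e.
  by rewrite -{1}(mul1x y) -(transE HE) y1 //; exact: S_G.
have half0 : 0 < 2^-1 :> C by rewrite invr_gt0.
have [m _ /(_ r (mem_head _ [::]))] := hy _ 0%N (near_phases [:: r] y half0).
apply: contraTeq => _; rewrite -real_leNgt ?normr_real ?rpredV ?realn //.
by rewrite ry distrC (dist_pw _ Dar) ar.
Qed.

(** The fixed degree climbs one step at a time: [Fix_one] starts, and [Fix_step] with j = m - (l +
    1) leads from l + 1 to l + 2. *)
Theorem Fix_of_unmoved m g : (forall c, N c -> Fx m.+1 c -> trans c g = g) ->
  Sm m.+2 g -> ~ Sm m.+1 g -> forall a, N a -> Fx m.+1 a.
Proof.
move=> nokill gS ngS a Na.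
suff H l : (l <= m)%N -> Fx l.+1 a by exact: (H m).
elim: l => [|l IH] lm; first exact: Fix_one nokill gS ngS Na.
have mE : (l.+2 + (m - l.+1) = m.+1)%N by lia.
apply: (@Fix_step l.+1 (m - l.+1) g a); rewrite ?mE //.
exact/IH/ltnW.
Qed.

End NormalSubgroups.

(** * Averaging over a closed normal subgroup *)

Lemma small_geometric (R : realType) (c z d : Cx R) : `|z| < 1 -> 0 < d ->
  exists k, `|c| * `|z| ^+ k < d.
Proof.
move=> z1 d0.
have [r [r0 r1 rE]] : exists r : R, [/\ 0 <= r, r < 1 & `|z| = r%:C%C].
  have zr : (complex.Re `|z|)%:C%C = `|z| by rewrite RRe_real // normr_real.
  exists (complex.Re `|z|).
  by split=> //; [rewrite -ler0c zr|rewrite -ltcR zr].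
have [M [M0 ME]] : exists M : R, 0 <= M /\ `|c| = M%:C%C.
  have zr : (complex.Re `|c|)%:C%C = `|c| by rewrite RRe_real // normr_real.
  exists (complex.Re `|c|).
  by split=> //; rewrite -ler0c zr.
case: d d0 => d d'; rewrite ltcE /= => /andP[/eqP -> d0].
have dM : 0 < d / (M + 1) by rewrite divr_gt0 // ltr_wpDl.
have /cvg_expr/cvgrPdist_lt/(_ _ dM)[k _ /(_ k (leqnn k))] : `|r| < 1 by rewrite ger0_norm.
rewrite /= sub0r normrN ger0_norm ?exprn_ge0 // => hk; exists k.
rewrite rE ME -[(d +i* 0)%C]/(d%:C%C) -rmorphXn -rmorphM ltcR.
apply: le_lt_trans (_ : (M + 1) * r ^+ k < _); first by rewrite ler_wpM2r ?exprn_ge0 // lerDl.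
by rewrite mulrC -ltr_pdivlMr // ltr_wpDl.
Qed.

Lemma midpoint_circle (C : numClosedFieldType) (z : C) :
  `|z| = 1 -> z != 1 -> `|(1 + z) / 2| < 1.
Proof.
move=> z1 zn1; rewrite normrM normfV normr_nat ltr_pdivrMr // mul1r lt_neqAle.
have -> : `|1 + z| <= 2.
  by apply: le_trans (ler_normD _ _) _; rewrite z1 normr1.
rewrite andbT; apply: contraNneq zn1 => h.
have : `|1 + z| = `|1| + `|z| by rewrite h z1 normr1.
by move=> /normCDeq[t _ [+ ->]]; rewrite normr1 z1 !mul1r => <-.
Qed.

Section Averaging.
Context (R : realType) (E : dynSys) (mul : E -> E -> E) (e : E).
Hypothesis HE : is_ellis mul e.
Local Notation C := (Cx R).
Local Notation U := (phase R E).
Local Notation se := (ds_map e).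
Local Notation Gt := (@quasi_phase R E mul e HE).
Local Notation Sm := (@degree_le_tors R E mul e HE).
Local Notation Fx := (@degree_stab R E mul e HE).
Local Notation trans := (@translate R E mul e HE).
Local Notation del := (@tdiff R E mul e HE).
Local Notation D := (del se).

Lemma tspan_trans (B : set U) a h : (forall p, B p -> B (trans a p)) ->
  tspan B h -> tspan B (fun x => h (mul x a)).
Proof.
move=> Ba [s [sB ->]]; apply: tspan_sum => p ps.
by apply: (@tspan_gen _ _ _ p.1 (trans a p.2)); exact/Ba/sB.
Qed.

Lemma tspan_split (B B' : set U) (g : U) h :
  (forall p, B p -> B' p \/ exists k : C, forall x, p x = k * g x) -> tspan B h ->
  exists c h', tspan B' h' /\ forall x, h x = c * g x + h' x.
Proof.
move=> BB' [s [sB ->]]; elim: s sB => [|p s IH] sB.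
  by exists 0, (fun=> 0); split=> [|x]; [exact: tspan0|rewrite big_nil mul0r addr0].
have [|c [h' [h'B hE]]] := IH.
  by move=> q qs; apply: sB; rewrite in_cons qs orbT.
have [pB|[k pk]] := BB' _ (sB p (mem_head _ _)).
  exists c, (fun x => p.1 * p.2 x + h' x); split=> [|x].
    by apply: tspan_add => //; exact: tspan_gen.
  by rewrite big_cons hE addrCA.
exists (p.1 * k + c), h'; split=> // x.
by rewrite big_cons hE pk mulrA mulrDl addrA.
Qed.

Variable f : E -> C.

(* Iterating the average of h and its translate by a damps the eigenvector g. *)
Lemma damp_eigenvector (B : set U) a (g : U) c h (d r : C) :
  (forall x, f (mul x a) = f x) -> (forall p, B p -> B (trans a p)) ->
  D (del a g) = 0 -> trans a g <> g -> tspan B h ->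
  (forall x, `|f x - (c * g x + h x)| < d) -> 0 < r ->
  exists2 h', tspan B h' & forall x, `|f x - h' x| < d + r.
Proof.
move=> fa Ba Dag ag hB fh r0.
pose z := (del a g) e; have z1 : `|z| = 1 by exact: norm_phase.
have gz x : g (mul x a) = z * g x.
  by rewrite -(transE HE) (trans_del HE) phaseD; have /D_eq0 -> := Dag.
have zn1 : z != 1.
  by apply: contra_notN ag => /eqP zE; apply/del_eq0; exact: const_eq0 Dag zE.
(* Averaging over e and a multiplies the coefficient of g by t, a strict contraction since z is not
   1. *)
pose t := (1 + z) / 2; have t1 : `|t| < 1 by exact: midpoint_circle.
have step k : exists2 hk, tspan B hk & forall x, `|f x - (c * t ^+ k * g x + hk x)| < d.
  elim: k => [|k [hk hkB fhk]]; first by exists h => // x; rewrite expr0 mulr1.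
  exists (fun x => 2^-1 * (hk x + hk (mul x a))).
    by apply/tspan_scale/tspan_add => //; exact: tspan_trans.
  move=> x; have := fhk x; have := fhk (mul x a); rewrite fa gz => h1 h2.
  have -> : f x - (c * t ^+ k.+1 * g x + 2^-1 * (hk x + hk (mul x a))) =
     2^-1 * ((f x - (c * t ^+ k * g x + hk x)) +
       (f x - (c * t ^+ k * (z * g x) + hk (mul x a)))).
    by rewrite exprSr /t; field.
  rewrite normrM ger0_norm ?invr_ge0 // mulrC ltr_pdivrMr // mulr_natr mulr2n.
  by apply: le_lt_trans (ler_normD _ _) _; exact: ltrD.
have [k hk] := small_geometric c t1 r0.
have [h' h'B fh'] := step k; exists h' => // x.
have -> : f x - h' x = (f x - (c * t ^+ k * g x + h' x)) + c * t ^+ k * g x by ring.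
apply: le_lt_trans (ler_normD _ _) _; apply: ltrD => //.
by rewrite !normrM normrX norm_phase mulr1.
Qed.

(** Constant multiples of members of [L] are added because an element that multiplies these members
    by constants must preserve the set. *)
Definition with_constants (B : set U) (L : seq U) : set U :=
  [set p | B p \/ exists2 g, g \in L & D (p - g) = 0].

Variable N : set E.
Hypothesis f_inv : forall a x, N a -> f (mul x a) = f x.

(** The members of [L] leave one at a time: one in [B] is absorbed, any other is damped as an
    eigenvector of its element of N, at the cost of half the remaining margin. *)
Lemma damp_list (B : set U) (L : seq U) :
  (forall a p, N a -> B p -> B (trans a p)) ->
  (forall p g, B g -> D (p - g) = 0 -> B p) ->
  (forall g, g \in L -> B g \/ exists a, [/\ N a, trans a g <> g &
     forall g', g' \in L -> D (del a g') = 0]) ->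
  forall h (d r : C), tspan (with_constants B L) h ->
  (forall x, `|f x - h x| < d) -> 0 < r ->
  exists2 h', tspan B h' & forall x, `|f x - h' x| < d + r.
Proof.
move=> Btrans Bconst; elim: L => [|g L IH] LB h d r hB fh r0.
  exists h; first by apply: tspan_mono hB => p [//|[]].
  by move=> x; apply: lt_le_trans (fh x) _; rewrite lerDl ltW.
have LB' g' : g' \in L -> B g' \/ exists a, [/\ N a, trans a g' <> g' &
    forall g'', g'' \in L -> D (del a g'') = 0].
  move=> g'L; have [|Bg'|[a [Na ag' aL]]] := LB g'; first by rewrite in_cons g'L orbT.
    by left.
  by right; exists a; split=> // g'' g''L; apply: aL; rewrite in_cons g''L orbT.
have r2 : 0 < r / 2 by rewrite divr_gt0.
have [Bg|[a [Na ag aL]]] := LB g (mem_head _ _).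
  apply: IH fh r0 => //; apply: tspan_mono hB => p [Bp|[g']]; first by left.
  by rewrite inE => /orP[/eqP ->|g'L] pg; [left; exact: Bconst pg|right; exists g'].
have [|c [h1 [h1B hE]]] := @tspan_split _ (with_constants B L) g _ _ hB.
  move=> p [Bp|[g']]; first by left; left.
  rewrite inE => /orP[/eqP ->|g'L] pg; last by left; right; exists g'.
  right; exists ((p - g) e) => x; have /D_eq0/(_ x) <- := pg.
  by rewrite phaseB divfK // phase_neq0.
have [|||||||h2 h2B fh2] := @damp_eigenvector (with_constants B L) a g c h1 d (r / 2).
- by move=> x; exact: f_inv.
- move=> p [Bp|[g' g'L pg']]; first by left; exact: Btrans.
  right; exists g' => //.
  have -> : trans a p - g' = trans a (p - g') + del a g'.
    by rewrite transB /tdiff addrA subrK.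
  apply/del_eq0; rewrite transD !(D_eq0_trans se) //; last by rewrite D_trans pg' trans0.
  by apply: aL; rewrite in_cons g'L orbT.
- by apply: aL; exact: mem_head.
- exact: ag.
- exact: h1B.
- by move=> x; rewrite -hE.
- exact: r2.
by rewrite [r]splitr addrA; apply: IH h2B fh2 r2.
Qed.

Hypothesis Hq : forall f : E -> C, continuous f -> approximable Gt f.
Hypotheses (N_closed : closed N) (N_e : N e)
  (N_mul : forall a b, N a -> N b -> N (mul a b))
  (N_comm : forall a b, N a -> exists2 c, N c & mul a b = mul (mul b a) c).

Definition invariant_phase : set U := [set g | Gt g /\ forall a, N a -> trans a g = g].

Lemma damp_to_invariant (L : seq U) h (d r : C) :
  (forall g, g \in L -> Gt g) -> (forall a g, N a -> g \in L -> D (del a g) = 0) ->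
  tspan [set p | p \in L] h -> (forall x, `|f x - h x| < d) -> 0 < r ->
  exists2 h', tspan invariant_phase h' & forall x, `|f x - h' x| < d + r.
Proof.
move=> LG LN hL fh r0; apply: (damp_list (L := L)) fh r0.
- by move=> a p Na [pG pN]; rewrite pN.
- move=> p g [Gg gN] pg; rewrite -[p](subrK g); split.
    have -> : p - g + g = (p - g) - (0 - g) by rewrite sub0r opprK.
    apply: Gall_sub; first by exists 0%N.
    by apply: Gall_sub => //; exists 0%N; exact: G_0.
  by move=> a Na; rewrite transD gN // (D_eq0_trans a pg).
- move=> g gL; have [gN|/existsNP[a /not_implyP[Na ag]]] :=
    pselect (forall a, N a -> trans a g = g); first by left; split=> //; exact: LG.
  by right; exists a; split=> // g' g'L; exact: LN.
- apply: tspan_mono hL => p pL; right; exists p => //.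
  by rewrite subrr del0.
Qed.

Lemma tspan_list (B : set U) h : tspan B h ->
  exists2 L : seq U, (forall g, g \in L -> B g) & tspan [set p | p \in L] h.
Proof.
move=> [s [sB ->]]; exists (map snd s) => [g /mapP[p ps ->]|]; first exact: sB.
by exists s; split=> // p ps /=; exact: map_f.
Qed.

(** Induction on m. In degree m + 2, if N fixes degree m + 1, it acts by constants and damping leads
    to invariant phases at once; otherwise each phase of exact degree is an eigenvector of an
    element of N, and damping lowers the degree. *)
Lemma invariant_approx_degree m h (d r : C) : tspan (Sm m) h ->
  (forall x, `|f x - h x| < d) -> 0 < r ->
  exists2 h', tspan invariant_phase h' & forall x, `|f x - h' x| < d + r.
Proof.
(* Degree 1 modulo torsion is spanned by genuine degree 1, on which all translations act by
   constants. *)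
have base h' d' r' : tspan (Sm 1) h' -> (forall x, `|f x - h' x| < d') -> 0 < r' ->
    exists2 h'', tspan invariant_phase h'' & forall x, `|f x - h'' x| < d' + r'.
  move=> /(tspan_sub (@S1_tspan R E mul e HE))/tspan_list[L LG hL].
  apply: damp_to_invariant hL => [g /LG gG|a g _ /LG gG]; first by exists 1%N.
  by have := G_del a gG.
elim: m h d r => [|[|m] IH] h d r hS fh r0; last 1 first; [|apply: base fh r0|exact: base fh r0].
  have [L LS hL] := tspan_list hS.
  have LD a g : Fx m.+1 a -> g \in L -> D (del a g) = 0.
    by move=> aF /LS gS; exact: Fix_del aF gS.
  have [NF|NF] := pselect (forall a, N a -> Fx m.+1 a).
    apply: damp_to_invariant hL fh r0 => [g /LS[]//|a g /NF]; exact: LD.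
  have r2 : 0 < r / 2 by rewrite divr_gt0.
  have hW : tspan (with_constants (Sm m.+1) L) h.
    by apply: tspan_mono hL => p pL; right; exists p => //; rewrite subrr del0.
  have [|||h' h'S fh'] := damp_list _ _ _ hW fh r2.
  - by move=> a p _; exact: S_trans.
  - move=> p g gS pg; rewrite -[p](subrK g); apply: S_add => //.
    by apply/(S_mono (leq0n _))/S_G.
  - move=> g gL; have [gS|ngS] := pselect (Sm m.+1 g); [by left|right].
    (* If no element of N fixing degree m + 1 moved g, [Fix_of_unmoved] would put N in the first
       case. *)
    apply: contrapT => no; apply: NF; apply: (Fix_of_unmoved Hq) (LS g gL) ngS => //.
    move=> c Nc cF; apply: contrapT => cg; apply: no; exists c; split=> // g' g'L.
    exact: LD.
  by rewrite [r]splitr addrA; exact: IH h'S fh' r2.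
by apply: tspan_mono hS => p; exact: S_mono.
Qed.

Theorem invariant_approximable : continuous f -> approximable invariant_phase f.
Proof.
move=> cf d d0; have d2 : 0 < d / 2 by rewrite divr_gt0.
have [h hG fh] := Hq cf d2; rewrite [d]splitr.
suff [m hm] : exists m, tspan (Sm m) h by exact: invariant_approx_degree hm fh d2.
case: hG => s [sG ->].
suff [m sm] : exists m, forall p, p \in s -> Sm m p.2 by exists m; exists s.
elim: s sG => [|p s IH] sG; first by exists 0%N.
have [|m sm] := IH; first by move=> q qs; apply: sG; rewrite in_cons qs orbT.
have [n np] := Gall_S (sG p (mem_head _ _)).
exists (maxn m n) => q; rewrite inE => /orP[/eqP ->|/sm].
  by apply: S_mono np; exact: leq_maxr.
by apply: S_mono; exact: leq_maxl.
Qed.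

End Averaging.

(** * Enveloping semigroups *)

Lemma prod_continuous (T : topologicalType) (I : Type) (X : I -> dynSys)
    (F : T -> prod_space X) :
  (forall i, continuous (fun t => F t i)) -> continuous F.
Proof.
move=> cF t; have FF : Filter (F @ t) by exact: (fmap_filter _ (nbhs_filter t)).
apply/cvg_sup => i U [_ [[W oW <-] Wf WU]].
have nW : nbhs t (fun s => W (F s i)) by apply: cF; exact: open_nbhs_nbhs.
by apply: (filterS _ nW) => s Ws; exact: WU.
Qed.

Section EnvelopingSemigroup.
Context (X : dynSys).
Local Notation XX := (prod_sys (fun _ : X => X)).
Local Notation E := (env_sys X).

Definition env_val (a : E) : XX := set_val a.

Lemma env_valP (a : E) : env_set (env_val a).
Proof. exact: set_valP. Qed.

Definition env_mk (a : XX) (Ea : env_set a) : E :=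
  exist (fun y => y \in (@env_set X)) a (mem_set Ea).

Lemma env_inj (a b : E) : env_val a = env_val b -> a = b.
Proof. exact: sub_val_inj. Qed.

Lemma env_val_continuous : continuous env_val.
Proof. exact: initial_continuous. Qed.

Lemma env_coord_continuous x : continuous (fun a : E => env_val a x).
Proof.
move=> a; apply: (@continuous_comp E XX X env_val (fun f : XX => f x)).
  exact: env_val_continuous.
exact: (@Defs.coord_continuous X (fun=> X) x (env_val a)).
Qed.

Lemma env_into_continuous (T : topologicalType) (F : T -> E) :
  (forall x, continuous (fun t => env_val (F t) x)) -> continuous F.
Proof. by move=> cF; apply: continuous_comp_initial; exact: prod_continuous. Qed.

Lemma env_val_map (a : E) : env_val (ds_map a) = ds_map (env_val a).
Proof. by []. Qed.

Lemma env_val_inv (a : E) : env_val (ds_inv a) = ds_inv (env_val a).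
Proof. by []. Qed.

Lemma env_set_id : env_set (idfun : XX).
Proof. by apply: subset_closure; exists 0. Qed.

Definition env_id : E := env_mk env_set_id.

Lemma env_set_ind (P : set XX) : closed P -> P idfun ->
  (forall a, P a -> P (@ds_map XX a)) -> (forall a, P a -> P (@ds_inv XX a)) ->
  (@env_set X) `<=` P.
Proof.
move=> cP P0 P1 P2 a Ea; apply: cP => B nB.
have [_ [[n _ <-] Bn]] := Ea B nB; exists (@ds_iter X n); split=> //.
case: n {Bn} => n; elim: n => [|n IH] //=; [exact: (P1 _ IH)|exact: (P2 _ P0)|].
exact: (P2 _ IH).
Qed.

Lemma env_ind (P : set E) : closed P -> P env_id ->
  (forall x, P x -> P (ds_map x)) -> (forall x, P x -> P (ds_inv x)) -> forall x, P x.
Proof.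
move=> cP P0 P1 P2 a; apply: cP => B [_ [[W oW <-] Wa WB]].
have [_ [[n _ <-] Wn]] := @env_valP a W (open_nbhs_nbhs (conj oW Wa)).
suff [b bn Pb] : exists2 b : E, env_val b = @ds_iter X n & P b.
  by exists b; split=> //; apply: WB; rewrite /= -[set_val b]/(env_val b) bn.
case: n {Wn} => n; elim: n => [|n [b bn Pb]].
- by exists env_id.
- by exists (ds_map b); [rewrite env_val_map bn|exact: P1].
- by exists (ds_inv env_id) => //; exact: P2.
- by exists (ds_inv b); [rewrite env_val_inv bn|exact: P2].
Qed.

(** For fixed b, the map c |-> c o b is continuous on X^X even if b is not, so density can be used
    in the left factor. *)
Lemma env_set_comp (a b : XX) : env_set a -> env_set b ->
  env_set (fun x => a (b x) : X).
Proof.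
move=> Ea Eb; pose F (c : XX) : XX := fun x => c (b x).
have cF : continuous F.
  by apply: prod_continuous => x; exact: (@Defs.coord_continuous X (fun=> X) (b x)).
apply: (env_set_ind (P := F @^-1` (@env_set X))) Ea => //.
- by move/continuous_closedP: cF; apply; exact: env_closed.
- by move=> c; exact: (ds_mapA (@env_invariant X)).
- by move=> c; exact: (ds_invA (@env_invariant X)).
Qed.

Definition env_mul (a b : E) : E := env_mk (env_set_comp (@env_valP a) (@env_valP b)).

Lemma env_ellis : is_ellis env_mul env_id.
Proof.
split.
- by move=> a b c; apply: env_inj.
- by move=> a; apply: env_inj.
- by move=> a; apply: env_inj.
- move=> a; apply: env_into_continuous => x.
  exact: (@env_coord_continuous (env_val a x)).
- by move=> a b; apply: env_inj.
- exact: env_ind.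
Qed.

End EnvelopingSemigroup.

Lemma W_systemP (R : realType) (X : dynSys) : W_system R X <->
  forall f : env_sys X -> Cx R, continuous f ->
    approximable (@quasi_phase R (env_sys X) (@env_mul X) (env_id X) (env_ellis X)) f.
Proof.
rewrite /W_system qdsP; set A := [set p | _].
suff -> : A = @quasi_phase R (env_sys X) (@env_mul X) (env_id X) (env_ellis X) by [].
by apply/seteqP; split=> g [m gm]; exists m; apply/(quasi_eigenE (env_ellis X)).
Qed.

(* The values are only required to lie in X^X: density of the orbit forces
   them into the enveloping semigroup of X. *)
Record env_morphism (Z X : dynSys) (p : env_sys Z -> prod_sys (fun _ : X => X)) : Prop :=
  EnvMorphism {
    em_continuous : continuous p;
    em_map : forall a, p (ds_map a) = ds_map (p a);
    em_id : p (env_id Z) = idfun }.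

(** * Transfer along morphisms of enveloping semigroups *)

Section Morphisms.
Context (R : realType) (Z X : dynSys) (p : env_sys Z -> prod_sys (fun _ : X => X)).
Hypothesis hp : env_morphism p.
Local Notation C := (Cx R).
Local Notation EZ := (env_sys Z).
Local Notation EX := (env_sys X).
Local Notation GZ := (@degree_le R EZ (@env_mul Z) (env_id Z) (env_ellis Z)).
Local Notation GX := (@degree_le R EX (@env_mul X) (env_id X) (env_ellis X)).

Lemma em_inv a : p (ds_inv a) = ds_inv (p a).
Proof. by rewrite -{2}(ds_invK a) (em_map hp) ds_mapK. Qed.

Lemma em_env a : env_set (p a).
Proof.
apply: (env_ind (P := p @^-1` (@env_set X))) => [|||].
- by move/continuous_closedP: (em_continuous hp); apply; exact: env_closed.
- by rewrite /preimage /= (em_id hp); exact: env_set_id.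
- by move=> x px; rewrite /preimage /= (em_map hp); exact: (ds_mapA (@env_invariant X)).
- by move=> x px; rewrite /preimage /= em_inv; exact: (ds_invA (@env_invariant X)).
Qed.

Definition em_lift (a : EZ) : EX := env_mk (@em_env a).

Lemma em_lift_continuous : continuous em_lift.
Proof. by apply: continuous_comp_initial; exact: (em_continuous hp). Qed.

Lemma em_lift_map a : em_lift (ds_map a) = ds_map (em_lift a).
Proof. by apply: env_inj; exact: (em_map hp a). Qed.

Lemma em_lift_inv a : em_lift (ds_inv a) = ds_inv (em_lift a).
Proof. by rewrite -{2}(ds_invK a) em_lift_map ds_mapK. Qed.

Lemma em_lift_id : em_lift (env_id Z) = env_id X.
Proof. by apply: env_inj; exact: (em_id hp). Qed.

(** Both sides are continuous in a and agree along the orbit of the identity. *)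
Lemma em_lift_mul a b : em_lift (env_mul a b) = env_mul (em_lift a) (em_lift b).
Proof.
apply: (env_ind (P := [set a | em_lift (env_mul a b) = env_mul (em_lift a) (em_lift b)])).
- apply: closed_agree; first exact: ds_hausdorff.
    move=> x; apply: (@continuous_comp EZ EZ EX ((@env_mul Z)^~ b) em_lift).
      exact: (ellis_continuous (env_ellis Z)).
    exact: em_lift_continuous.
  move=> x; apply: (@continuous_comp EZ EX EX em_lift ((@env_mul X)^~ (em_lift b))).
    exact: em_lift_continuous.
  exact: (ellis_continuous (env_ellis X)).
- by rewrite /= em_lift_id (ellis_mul1x (env_ellis Z)) (ellis_mul1x (env_ellis X)).
- move=> x IH; rewrite /= -(ellis_map (env_ellis Z)) !em_lift_map IH.
  by rewrite (ellis_map (env_ellis X)).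
- move=> x IH; rewrite /= -(ellis_inv (env_ellis Z)) !em_lift_inv IH.
  by rewrite (ellis_inv (env_ellis X)).
Qed.

Lemma em_lift_surj b : exists a, em_lift a = b.
Proof.
suff [a _ ab] : range em_lift b by exists a.
apply: (env_ind (P := range em_lift)) => [||x|x].
- apply: compact_closed; first exact: ds_hausdorff.
  apply: continuous_compact; last exact: ds_compact.
  by apply: continuous_subspaceT; exact: em_lift_continuous.
- by exists (env_id Z) => //; exact: em_lift_id.
- by move=> [a _ <-]; exists (ds_map a) => //; exact: em_lift_map.
- by move=> [a _ <-]; exists (ds_inv a) => //; exact: em_lift_inv.
Qed.

Lemma em_lift_G m (g : phase R EZ) (g' : phase R EX) :
  (forall x, g' (em_lift x) = g x) -> GX m g' <-> GZ m g.
Proof.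
move=> gg'; have DnE n x :
    tdiff_iter (env_ellis X) n g' (em_lift x) = tdiff_iter (env_ellis Z) n g x.
  elim: n x => [|n IH] x; first exact: gg'.
  rewrite !DnS /tdiff !phaseB !transE (mul_map_r (env_ellis X)) (mul_map_r (env_ellis Z)).
  by rewrite -em_lift_map !IH.
split=> gm; rewrite GE; apply/phase_eqP => x.
  by rewrite -DnE; move: gm; rewrite GE => ->.
by have [a <-] := em_lift_surj x; rewrite DnE; move: gm; rewrite GE => ->.
Qed.

Lemma em_lift_circle (g : phase R EX) : @circle_fun R EZ (fun x => g (em_lift x)).
Proof.
split=> [x|x]; last exact: norm_phase.
apply: (@continuous_comp EZ EX C em_lift g); first exact: em_lift_continuous.
exact: phase_continuous.
Qed.

Hypothesis WZ : W_system R Z.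

Let Hq := (W_systemP R Z).1 WZ.
Let em_kernel : set EZ := [set a | em_lift a = env_id X].

Lemma em_kernel_comm a b : em_kernel a ->
  exists2 c, em_kernel c & env_mul a b = env_mul (env_mul b a) c.
Proof.
rewrite /em_kernel /= => Na.
have mulA := ellis_mulA (env_ellis Z); have mulA' := ellis_mulA (env_ellis X).
have [i [iba bai]] := ellis_inverse Hq (env_mul b a).
exists (env_mul i (env_mul a b)); last first.
  by rewrite mulA bai (ellis_mul1x (env_ellis Z)).
rewrite /= 2!em_lift_mul Na (ellis_mul1x (env_ellis X)).
rewrite -em_lift_id -iba !em_lift_mul Na.
by rewrite (ellis_mulx1 (env_ellis X)).
Qed.

(** The fibres are cosets of the kernel, which contains y^(-1) x. *)
Lemma em_kernel_fiber (g : phase R EZ) x y :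
  (forall a, em_kernel a -> translate (env_ellis Z) a g = g) ->
  em_lift x = em_lift y -> g x = g y.
Proof.
move=> gN xy; have [i [iy yi]] := ellis_inverse Hq y.
have : em_kernel (env_mul i x).
  by rewrite /em_kernel /= em_lift_mul xy -em_lift_mul iy em_lift_id.
move=> /gN gix; rewrite -[in RHS]gix transE (ellis_mulA (env_ellis Z)) yi.
by rewrite (ellis_mul1x (env_ellis Z)).
Qed.

(** Invariance makes g constant on fibres. The induced function is continuous because [em_lift],
    from a compact to a Hausdorff space, is a closed map. *)
Lemma em_descend (g : phase R EZ) :
  (forall a, em_kernel a -> translate (env_ellis Z) a g = g) ->
  exists g' : phase R EX, forall x, g' (em_lift x) = g x.
Proof.
move=> gN; have [s sE] := choice em_lift_surj.
pose k y := g (s y).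
have kE x : k (em_lift x) = g x by apply: em_kernel_fiber => //; exact: sE.
suff kc : @circle_fun R EX k by exists (Phase kc).
split=> [|x]; last exact: norm_phase.
apply/continuous_closedP => A cA.
have -> : k @^-1` A = em_lift @` (g @^-1` A).
  apply/seteqP; split=> [y kA|_ [x gA <-]]; last by rewrite /preimage /= kE.
  by exists (s y).
apply: compact_closed; first exact: ds_hausdorff.
apply: continuous_compact.
  by apply: continuous_subspaceT; exact: em_lift_continuous.
apply: (subclosed_compact _ (@ds_compact EZ)) => //.
by move/continuous_closedP : (@phase_continuous _ _ g); apply.
Qed.

(** The pullback of f is invariant under the kernel of [em_lift], a closed normal subgroup; its
    invariant approximants descend to quasi-eigenfunctions of the same degree. *)
Lemma W_system_transfer : W_system R X.
Proof.
apply/W_systemP => f cf d d0.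
have cfl : continuous (fun x => f (em_lift x)).
  move=> x; apply: (@continuous_comp EZ EX C em_lift f); first exact: em_lift_continuous.
  exact: cf.
have N_closed : closed em_kernel.
  apply: closed_agree; [exact: ds_hausdorff|exact: em_lift_continuous|].
  by move=> x; exact: cst_continuous.
have N_mul a b : em_kernel a -> em_kernel b -> em_kernel (env_mul a b).
  rewrite /em_kernel /= => Na Nb.
  by rewrite em_lift_mul Na Nb (ellis_mul1x (env_ellis X)).
have f_inv a x : em_kernel a -> f (em_lift (env_mul x a)) = f (em_lift x).
  by move=> Na; rewrite em_lift_mul Na (ellis_mulx1 (env_ellis X)).
have [h hN fh] := invariant_approximable f_inv Hq N_closed em_lift_id N_mul
  em_kernel_comm cfl d0.
suff [h' h'G hh'] : exists2 h', tspan (@quasi_phase R EX (@env_mul X) (env_id X) (env_ellis X)) h' &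
    forall x, h' (em_lift x) = h x.
  by exists h' => // y; have [x <-] := em_lift_surj y; rewrite hh'.
case: hN => s [sN ->]; elim: s sN => [|q s IH] sN.
  by exists (fun=> 0) => [|x]; [exact: tspan0|rewrite big_nil].
have [|h1 h1G hh1] := IH; first by move=> r rs; apply: sN; rewrite in_cons rs orbT.
have [[m qm] qN] := sN q (mem_head _ _).
have [g' gE] := em_descend qN.
exists (fun y => q.1 * g' y + h1 y) => [|x]; last by rewrite big_cons gE hh1.
by apply: tspan_add => //; apply: tspan_gen; exists m; apply/(em_lift_G m gE).
Qed.

End Morphisms.

(** Phases pulled back along the morphisms p keep their degree and together separate points, so
    Stone-Weierstrass applies. *)
Lemma W_system_separated (R : realType) (Z : dynSys) :
  (forall a b : env_sys Z, a <> b ->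
     exists (X : dynSys) (p : env_sys Z -> prod_sys (fun _ : X => X)),
     [/\ W_system R X, env_morphism p & p a <> p b]) -> W_system R Z.
Proof.
move=> sep; apply/W_systemP => f cf; apply: complex_stone_weierstrass => //.
- by exists 0%N; exact: G_0.
- by move=> g h; exact: Gall_sub.
move=> a b gab; congr f; apply: contrapT => /sep[X [p [WX hp pab]]].
apply: pab; suff /(congr1 (@env_val X)) : em_lift hp a = em_lift hp b by [].
apply: (Gall_separates ((W_systemP R X).1 WX)) => g [m gm].
apply: (gab (Phase (em_lift_circle hp g))); exists m.
have /(em_lift_G m)[h _] : forall x, g (em_lift hp x) = Phase (em_lift_circle hp g) x by [].
exact: h.
Qed.

(** * Factors, subsystems, products *)

Section Permanence.
Variable R : realType.

Lemma W_system_factor (X Y : dynSys) : W_system R X -> is_factor_of Y X -> W_system R Y.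
Proof.
move=> WX [q [cq qsurj qmap]]; have [s sE] := choice qsurj.
(* s is a section of q, possibly discontinuous; p is continuous because it is so in a for each fixed
   y. *)
pose p (a : env_sys X) : prod_sys (fun _ : Y => Y) := fun y => q (env_val a (s y)).
apply: (@W_system_transfer R X Y p) => //; split.
- apply: prod_continuous => y a.
  apply: (@continuous_comp (env_sys X) X Y (fun a : env_sys X => env_val a (s y)) q).
    exact: (@env_coord_continuous X (s y)).
  exact: cq.
- by move=> a; apply/funext => y; exact: qmap.
- by apply/funext => y; exact: sE.
Qed.

Lemma W_system_restr (X : dynSys) (A : set X) (clA : closed A) (sA : @ds_map X @` A = A) :
  W_system R X -> W_system R (restr_sys clA sA).
Proof.
move=> WX; set Y := restr_sys clA sA.
(* Elements of the enveloping semigroup preserve the closed invariant set A, so they restrict to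
   it. *)
have env_A (a : env_sys X) (x : A) : A (env_val a (set_val x)).
  apply: (env_ind (P := [set a | A (env_val a (set_val x))])) => [|||].
  - have /continuous_closedP := @env_coord_continuous X (set_val x).
    by apply.
  - exact: set_valP.
  - by move=> b; exact: (ds_mapA sA).
  - by move=> b; exact: (ds_invA sA).
pose p (a : env_sys X) : prod_sys (fun _ : Y => Y) :=
  fun x => exist (fun y => y \in A) _ (mem_set (env_A a x)).
apply: (@W_system_transfer R X Y p) => //; split.
- apply: prod_continuous => x; apply: continuous_comp_initial.
  exact: (@env_coord_continuous X (set_val x)).
- by move=> a; apply/funext => x; exact: sub_val_inj.
- by apply/funext => x; exact: sub_val_inj.
Qed.

Lemma W_system_prod (I : Type) (X : I -> dynSys) :
  (forall i, W_system R (X i)) -> W_system R (prod_sys X).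
Proof.
move=> WX; apply: W_system_separated => a b ab.
have [x abx] : exists x, env_val a x <> env_val b x.
  apply: contrapT => no; apply: ab; apply: env_inj; apply/funext => x.
  by apply: contrapT => abx; apply: no; exists x.
have [i abi] : exists i, env_val a x i <> env_val b x i.
  apply: contrapT => no; apply: abx; apply: functional_extensionality_dep => i.
  by apply: contrapT => abi; apply: no; exists i.
(* y is inserted at coordinate i of x and coordinate i of the image is read off. For y = x i this is
   the place where a and b differ. *)
pose upd (y : X i) : prod_sys X := @dfwith {classic I} (fun j => X j) x i y.
pose p (c : env_sys (prod_sys X)) : prod_sys (fun _ : X i => X i) :=
  fun y => env_val c (upd y) i.
exists (X i), p; split=> //; first split.
- apply: prod_continuous => y c.
  apply: (@continuous_comp (env_sys (prod_sys X)) (prod_sys X) (X i)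
    (fun c : env_sys (prod_sys X) => env_val c (upd y)) (fun z : prod_sys X => z i)).
    exact: (@env_coord_continuous (prod_sys X) (upd y)).
  exact: (@Defs.coord_continuous I X i).
- by move=> c; apply/funext.
- by apply/funext => y; exact: (@dfwith_in {classic I} (fun j => X j)).
move=> /(congr1 (fun h => h (x i))); rewrite /p.
suff -> : upd (x i) = x by [].
apply: functional_extensionality_dep => j; rewrite /upd.
by case: (@dfwithP {classic I} (fun j => X j)).
Qed.

End Permanence.

Theorem proposition5p13 (R : realType) :
  (forall X Y : dynSys, W_system R X -> is_factor_of Y X -> W_system R Y) /\
  (forall (X : dynSys) (A : set X) (hA : is_subsystem A),
     W_system R X -> W_system R (subsystem hA)) /\
  (forall (I : Type) (X : I -> dynSys),
     (forall i, W_system R (X i)) -> W_system R (prod_sys X)) /\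
  (forall (I : Type) (le : I -> I -> Prop) (X : I -> dynSys)
     (p : forall i j, le i j -> X j -> X i) (hp : is_inverse_system p),
     (forall i, W_system R (X i)) -> W_system R (inv_lim hp)).
Proof.
split; first exact: W_system_factor.
split=> [X A [A0 clA sA] WX|]; first exact: W_system_restr.
split=> [I X|I le X p hp WX]; first exact: W_system_prod.
by apply: W_system_restr; exact: W_system_prod.
Qed.
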